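(* Let $s>\frac12$, let $k\in\mathbb{N}=\{1,2,\ldots\}$, let $T,\kappa>0$, and set $c_0=l_{\kappa,T}(k)^{-1}$. Suppose that $\dim\ker D_uF_\kappa(0,c_0)=1$, where the kernel is taken in $\mathcal{C}^s_{\mathrm{even}}(\mathbb{S})$. Then there exists a smooth curve $$\{(u(t),c(t)) : 0<|t|\ll 1\}$$ in $\mathcal{C}^s_{\mathrm{even}}(\mathbb{S})\times\mathbb{R}$ of small-amplitude, $2\pi$-periodic, even solutions of $F_\kappa(u,c)=0$. These solutions satisfy $$u(t)=t\cos(kx)+\mathcal{O}(t^2),\qquad c(t)=c_0+\mathcal{O}(t)$$ in $\mathcal{C}^s_{\mathrm{even}}(\mathbb{S})\times\mathbb{R}$, and constitute all nontrivial solutions (i.e. solutions with $u\neq 0$) of $F_\kappa(u,c)=0$ in a neighbourhood of $(0,c_0)$ in that space.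
   Context: For $T,\kappa>0$ let $l_T(\xi)=\left(\frac{\xi}{(1+T\xi^2)\tanh(\xi)}\right)^{1/2}$ for $\xi\neq0$, $l_T(0)=1$, and $l_{\kappa,T}(\xi)=l_T(\kappa\xi)$. $L_{\kappa,T}$ is the Fourier multiplier operator with symbol $l_{\kappa,T}$; on $2\pi$-periodic functions it multiplies the $n$-th Fourier coefficient by $l_{\kappa,T}(n)$, $n\in\mathbb{Z}$. Zygmund spaces: let $\{\psi_j^2\}_{j\geq0}$ be a smooth partition of unity on $\mathbb{R}$ with $\psi_0$ supported in $|\xi|\leq1$, $\psi_1$ supported in $\frac12\leq|\xi|\leq2$, and $\psi_j(\xi)=\psi_1(2^{1-j}\xi)$ for $j\geq2$; $\mathcal{C}^s(\mathbb{R})$ is the space of $u$ with $\|u\|_{\mathcal{C}^s}=\sup_j 2^{js}\|\psi_j^2(D)u\|_{L^\infty}<\infty$, where $\psi_j^2(D)u=\mathcal{F}^{-1}(\psi_j^2\hat u)$ (for non-integer $s>0$ this is the usual Hölder space). $\mathcal{C}^s(\mathbb{S})$ denotes the $2\pi$-periodic functions in $\mathcal{C}^s(\mathbb{R})$, and $\mathcal{C}^s_{\mathrm{even}}(\mathbb{S})$ its subspace of even (real-valued) functions. Define $F_\kappa:\mathcal{C}^s_{\mathrm{even}}(\mathbb{S})\times\mathbb{R}\to\mathcal{C}^s_{\mathrm{even}}(\mathbb{S})$ by $F_\kappa(u,c)=u-cL_{\kappa,T}u+L_{\kappa,T}(u^2)$. Its zeros are the even, $2\pi$-periodic solutions of the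 steady capillary-gravity Whitham equation $-cu+L_{\kappa,T}^{-1}u+u^2=0$ with wavespeed $c$. The linearisation is $D_uF_\kappa(0,c_0)=\mathrm{Id}-c_0L_{\kappa,T}$. *)

(* Defs.v *)
From HB Require Import structures.
From mathcomp Require Import all_boot all_order all_algebra.
From mathcomp Require Import all_classical all_reals all_analysis.
From mathcomp Require Import complex.

Set Implicit Arguments.
Unset Strict Implicit.
Unset Printing Implicit Defensive.

Import Order.TTheory GRing.Theory Num.Theory.
Import numFieldNormedType.Exports.

Local Open Scope classical_set_scope.
Local Open Scope ring_scope.
Local Open Scope complex_scope.

Section Fourier.
Context {R : realType}.
Implicit Types (u : R -> R) (m : R -> R) (n : int).

(* (1 / 2pi) * int_(-pi)^pi u(x) e^(-inx) dx *)
Definition fourier_coef u n : R[i] :=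
  let I (g : R -> R) :=
    (2 * pi)^-1 * \int[@lebesgue_measure R]_(x in `[- pi, pi]) (u x * g x) in
  I (fun x => cos (n%:~R * x)) -i* I (fun x => sin (n%:~R * x)).

Definition expi (x : R) : R[i] := cos x +i* sin x.

(* The multiplier operator m(D) on 2pi-periodic functions, as the limit of the
   symmetric partial sums of sum_n m(n) u^(n) e^(inx). The limit is taken
   componentwise because the library infers no topology on R[i]. *)
Definition multiplier_sum m u (x : R) (N : nat) : R[i] :=
  \sum_(0 <= j < N.*2.+1) let n := j%:Z - N%:Z in
    (m n%:~R)%:C * fourier_coef u n * expi (n%:~R * x).

Definition multiplier m u (x : R) : R[i] :=
  limn (fun N => complex.Re (multiplier_sum m u x N)) +i*
  limn (fun N => complex.Im (multiplier_sum m u x N)).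

End Fourier.

Section Zygmund.
Context {R : realType}.
Implicit Types (psi : nat -> R -> R) (s : R) (u : R -> R).

(* {psi_j ^ 2} is the partition of unity; only the squares need be smooth, and
   the psi_j need not be even. *)
Record zygmund_partition psi : Prop := ZygmundPartition {
  partition_smooth : forall j n x,
    derivable (derive1n n (fun y => psi j y ^+ 2)) x 1;
  partition_supp0 : forall x, 1 < `|x| -> psi 0%N x = 0;
  partition_supp1 : forall x, ~~ (2^-1 <= `|x| <= 2) -> psi 1%N x = 0;
  partition_dyadic : forall j x, (2 <= j)%N ->
    psi j x = psi 1%N (2 `^ (1 - j%:R) * x);
  partition_sum1 : forall x,
    (\sum_(0 <= j < N) psi j x ^+ 2) @[N --> \oo] --> (1 : R) }.

(* sup_j 2^(js) * sup_x |psi_j^2(D) u (x)|: psi_j^2(D) u is a trigonometric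
   polynomial, so that its essential supremum is a supremum. *)
Definition zygmund_norm psi s u : \bar R :=
  ereal_sup [set (2 `^ (j%:R * s) *
      ComplexField.Normc.normc (multiplier (fun xi => psi j xi ^+ 2) u x))%:E
    | j in [set: nat] & x in [set: R]].

(* For s > 0 every class in C^s has a unique continuous representative. *)
Definition zygmund_per psi s : set (R -> R) :=
  [set u | [/\ continuous u, forall x, u (x + 2 * pi) = u x &
               (zygmund_norm psi s u < +oo)%E]].

Definition zygmund_even psi s : set (R -> R) :=
  [set u | zygmund_per psi s u /\ forall x, u (- x) = u x].

(* u, restricted to ]-eps, eps[, is a C^oo curve in the normed space
   zygmund_even psi s; U n is its n-th derivative. *)
Definition zygmund_smooth_curve psi s (eps : R) (u : R -> R -> R) : Prop :=
  exists U : nat -> R -> R -> R,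
    (forall t, `|t| < eps -> U 0%N t = u t) /\
    forall n t, `|t| < eps -> zygmund_even psi s (U n t) /\
      zygmund_norm psi s (h^-1 *: (U n (t + h) - U n t) - U n.+1 t)
        @[h --> (0 : R)^'] --> 0%E.

End Zygmund.

(* The set K is a vector subspace of V with a basis of d elements. *)
Definition has_dim (F : fieldType) (V : lmodType F) (K : set V) (d : nat) :
    Prop :=
  exists e : 'I_d -> V,
    (forall a : 'I_d -> F, \sum_i a i *: e i = 0 -> forall i, a i = 0) /\
    K = [set \sum_i a i *: e i | a in [set: 'I_d -> F]].

Section Whitham.
Context {R : realType}.
Implicit Types (T kappa c xi : R) (u v : R -> R).

Definition tanh (x : R) : R :=
  (expR x - expR (- x)) / (expR x + expR (- x)).

Definition whitham_symbol T xi : R :=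
  if xi == 0 then 1 else Num.sqrt (xi / ((1 + T * xi ^+ 2) * tanh xi)).

Definition scaled_symbol kappa T xi : R := whitham_symbol T (kappa * xi).

(* The symbol is real and even, so that the operator maps real functions to
   real functions. *)
Definition whitham_op kappa T u : R -> R :=
  fun x => complex.Re (multiplier (scaled_symbol kappa T) u x).

Definition whitham_map kappa T u c : R -> R :=
  fun x => u x - c * whitham_op kappa T u x
           + whitham_op kappa T (fun y => u y ^+ 2) x.

(* D_u F(0, c) = Id - c L *)
Definition whitham_linearization kappa T c v : R -> R :=
  fun x => v x - c * whitham_op kappa T v x.

Definition linearization_kernel psi s kappa T c : set (R -> R) :=
  [set v | zygmund_even psi s v /\ whitham_linearization kappa T c v = cst 0].

End Whitham.

(* Main.v *)
(** Expand even 2pi-periodic functions in cosines and work in the weighted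
    Wiener algebras [sum |amp u n| (n+1)^p < oo]. Bernstein's inequality embeds
    C^s into the unweighted algebra (this is where s > 1/2 enters) and, for
    p >= s, the weighted algebra embeds into C^s. So existence can be proved in
    a strong norm, uniqueness in a weak one, and no estimate of the operator on
    Zygmund spaces is needed.

    Let l be the symbol, e = cos(kx), [.]_k the k-th cosine amplitude, and M the
    multiplier with symbol l(n) / (1 - c0 l(n)) for n <> k and 0 for n = k. It is
    bounded because l tends to 0 and, the kernel being one-dimensional,
    l(n) <> l(k) for n <> k. Substituting u = t y, the mode k of the equation
    gives c = c0 + t [y^2]_k, and the other modes become the fixed-point equation
        y = e + t M([y^2]_k y - y^2).
    It has a power series solution y(t) = sum t^m y_m whose coefficients are
    cosine polynomials defined by recursion, with a geometric majorant; hence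
    u and c are smooth in t. Conversely, a small solution v with k-th amplitude t
    satisfies |v| <= 2 |t|, so that t <> 0, and v / t solves the same fixed-point
    equation, which is a contraction for small t. *)

Require Import Defs.
From mathcomp Require Import all_boot all_order all_algebra.
From mathcomp Require Import all_classical all_reals all_analysis.
From mathcomp Require Import complex ring lra.

Set Implicit Arguments.
Unset Strict Implicit.
Unset Printing Implicit Defensive.

Import Order.TTheory GRing.Theory Num.Theory.
Import numFieldNormedType.Exports.

Local Open Scope classical_set_scope.
Local Open Scope ring_scope.

(** * Averages over a period *)

(** The equation concerns functions, and its operator is a pointwise limit of partial sums, whereas
    all estimates concern amplitudes. The link is that an even, continuous, periodic function is
    determined by its cosine amplitudes; every identity between functions is checked mode by mode
    through it. The Wiener norm never appears as a number: [wbound p f B] bounds all partial sums,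
    so it includes summability and survives limits. The price is that a contraction must be run by
    repeatedly improving a bound. Power series take the place of the implicit function theorem and
    give all derivatives of the curve at once; their coefficients are finite lists of cosine terms,
    so the recursive estimates involve finite sums only. The strong and the weak norm meet because a
    weighted bound is also an unweighted one: the branch lies in the class on which the contraction
    acts, and [eps] is small enough for the majorant and the contraction together. *)

Section Average.
Context {R : realType}.
Implicit Types f g : R -> R.

Definition avg f : R :=
  (2 * pi)^-1 * \int[@lebesgue_measure R]_(x in `[- pi, pi]) f x.

Lemma continuous_fun_cst (c : R) : continuous (fun _ : R => c).
Proof. by move=> x; apply: cvg_cst. Qed.

Lemma continuous_funD f g : continuous f -> continuous g ->
  continuous (fun x => f x + g x).
Proof. by move=> cf cg x; apply: cvgD; [exact: cf|exact: cg]. Qed.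

Lemma continuous_funB f g : continuous f -> continuous g ->
  continuous (fun x => f x - g x).
Proof. by move=> cf cg x; apply: cvgB; [exact: cf|exact: cg]. Qed.

Lemma continuous_funM f g : continuous f -> continuous g ->
  continuous (fun x => f x * g x).
Proof. by move=> cf cg x; apply: cvgM; [exact: cf|exact: cg]. Qed.

Lemma continuous_funX f n : continuous f -> continuous (fun x => f x ^+ n).
Proof.
move=> cf; elim: n => [|n IH]; first exact: continuous_fun_cst.
by under eq_fun do rewrite exprS; apply: continuous_funM.
Qed.

Lemma continuous_fun_sum (I : Type) (r : seq I) (P : pred I) (F : I -> R -> R) :
  (forall i, continuous (F i)) -> continuous (fun x => \sum_(i <- r | P i) F i x).
Proof.
move=> cF; elim: r => [|i r IH].
  by under eq_fun do rewrite big_nil; exact: continuous_fun_cst.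
under eq_fun do rewrite big_cons; case: (P i) => //.
exact: continuous_funD.
Qed.

Lemma continuous_cosM (a : R) : continuous (fun x => cos (a * x)).
Proof.
move=> x; apply: (@continuous_comp _ _ _ (fun x => a * x) (@cos R)).
  by apply: mulrl_continuous.
exact: continuous_cos.
Qed.

Lemma continuous_sinM (a : R) : continuous (fun x => sin (a * x)).
Proof.
move=> x; apply: (@continuous_comp _ _ _ (fun x => a * x) (@sin R)).
  by apply: mulrl_continuous.
exact: continuous_sin.
Qed.

Lemma continuous_integrable_pi f : continuous f ->
  (@lebesgue_measure R).-integrable `[- pi, pi] (EFin \o f).
Proof.
move=> cf; apply: continuous_compact_integrable; first exact: segment_compact.
exact: continuous_subspaceT.
Qed.

Let pi0 : 0 < 2 * pi :> R.
Proof. by rewrite mulr_gt0 // pi_gt0. Qed.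

Lemma avgD f g : continuous f -> continuous g ->
  avg (fun x => f x + g x) = avg f + avg g.
Proof.
move=> cf cg; rewrite /avg -mulrDr RintegralD //; exact: continuous_integrable_pi.
Qed.

Lemma avgZ (a : R) f : continuous f -> avg (fun x => a * f x) = a * avg f.
Proof.
move=> cf; rewrite /avg mulrCA; congr (_ * _).
by rewrite RintegralZl //; exact: continuous_integrable_pi.
Qed.

Lemma avgB f g : continuous f -> continuous g ->
  avg (fun x => f x - g x) = avg f - avg g.
Proof.
move=> cf cg; rewrite /avg -mulrBr RintegralB //; exact: continuous_integrable_pi.
Qed.

Lemma avg_cst (a : R) : avg (fun _ => a) = a.
Proof.
rewrite /avg Rintegral_cst // [X in fine X]lebesgue_measure_itv /= lte_fin.
rewrite ifT; last by have := @pi_gt0 R; lra.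
rewrite /= opprK -mulr2n -[pi *+ 2]mulr_natl mulrCA mulVf ?mulr1 //.
by rewrite gt_eqF.
Qed.

Lemma avg_sum (I : Type) (r : seq I) (P : pred I) (F : I -> R -> R) :
  (forall i, continuous (F i)) ->
  avg (fun x => \sum_(i <- r | P i) F i x) = \sum_(i <- r | P i) avg (F i).
Proof.
move=> cF; elim: r => [|i r IH].
  by rewrite big_nil -[RHS](avg_cst 0); congr avg; apply/funext => x; rewrite big_nil.
rewrite big_cons; under eq_fun do rewrite big_cons.
case: (P i) => //; rewrite avgD ?IH //; exact: continuous_fun_sum.
Qed.

Lemma le_avg f g : continuous f -> continuous g ->
  (forall x, `|x| <= pi -> f x <= g x) -> avg f <= avg g.
Proof.
move=> cf cg fg; rewrite /avg ler_pM2l ?invr_gt0 //.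
apply: le_Rintegral => //; try exact: continuous_integrable_pi.
by move=> x; rewrite /= in_itv /= => xpi; apply: fg; rewrite ler_norml.
Qed.

Lemma norm_avg_le f (B : R) : continuous f -> (forall x, `|f x| <= B) ->
  `|avg f| <= B.
Proof.
move=> cf fB; rewrite ler_norml -{1}(avg_cst (- B)) -{2}(avg_cst B).
by apply/andP; split; apply: le_avg => //; try exact: continuous_fun_cst;
  move=> x _; have := fB x; rewrite ler_norml => /andP[].
Qed.

Lemma avg_gt0 f (x0 d a : R) : continuous f -> 0 < d -> 0 < a ->
  - pi <= x0 - d -> x0 + d <= pi ->
  (forall x, 0 <= f x) -> (forall x, `|x - x0| <= d -> a <= f x) -> 0 < avg f.
Proof.
move=> cf d0 a0 xd1 xd2 f0 fa; rewrite /avg mulr_gt0 ?invr_gt0 //.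
apply: (@lt_le_trans _ _ (\int[@lebesgue_measure R]_(x in `[x0 - d, x0 + d]) a)).
  rewrite Rintegral_cst // [X in fine X]lebesgue_measure_itv /= lte_fin ifT; last by lra.
  by rewrite /= mulr_gt0 //; lra.
have sub : `[x0 - d, x0 + d] `<=` `[- pi, pi].
  by move=> x; rewrite /= !in_itv /= => /andP[h1 h2]; apply/andP; split; lra.
have ipi := continuous_integrable_pi cf.
have isub : (@lebesgue_measure R).-integrable `[x0 - d, x0 + d] (EFin \o f).
  by apply: integrableS ipi.
apply: (@le_trans _ _ (\int[@lebesgue_measure R]_(x in `[x0 - d, x0 + d]) f x)).
  apply: le_Rintegral => //.
    apply: continuous_compact_integrable; first exact: segment_compact.
    by apply: continuous_subspaceT; exact: continuous_fun_cst.
  by move=> x; rewrite /= in_itv /= => h; apply: fa; rewrite ler_norml; lra.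
rewrite /Rintegral fine_le //; try exact: integrable_fin_num.
apply: ge0_subset_integral => //.
  by case/integrableP : ipi.
by move=> x _; rewrite lee_fin.
Qed.

Lemma avg_opp f : continuous f -> avg (fun x => f (- x)) = avg f.
Proof.
move=> cf; rewrite /avg /Rintegral; congr (_ * fine _).
have := @integration_by_substitution_oppr R f (- pi) pi.
rewrite opprK => -> //; first by have := @pi_gt0 R; lra.
exact: continuous_subspaceT.
Qed.

Lemma avg_odd f : continuous f -> (forall x, f (- x) = - f x) -> avg f = 0.
Proof.
move=> cf fN; have := avg_opp cf.
rewrite (_ : (fun x => f (- x)) = (fun x => -1 * f x)); last first.
  by apply/funext => x; rewrite fN mulN1r.
by rewrite avgZ // mulN1r => h; lra.
Qed.

Lemma sin_natpi (n : nat) : sin (n%:R * pi) = 0 :> R.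
Proof.
elim: n => [|n IH]; first by rewrite mul0r sin0.
by rewrite -natr1 mulrDl mul1r sinDpi IH oppr0.
Qed.

Lemma avg_cos (n : nat) : avg (fun x => cos (n%:R * x)) = (n == 0%N)%:R.
Proof.
case: n => [|n].
  by under eq_fun do rewrite mul0r cos0; rewrite avg_cst.
have n0 : n.+1%:R != 0 :> R by rewrite pnatr_eq0.
pose F (x : R) := (n.+1%:R)^-1 * sin (n.+1%:R * x).
have dF (x : R) : is_derive x (1 : R) F (cos (n.+1%:R * x)).
  have : is_derive x (1 : R) F (n.+1%:R^-1 *: (n.+1%:R * cos (n.+1%:R * x))).
    apply: is_deriveZ.
    have lin : is_derive x (1 : R) ( *%R n.+1%:R) n.+1%:R.
      have := @is_deriveZ R R R id n.+1%:R x 1 1 (is_derive_id _ _).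
      by rewrite /GRing.scale /= mulr1.
    have := @is_derive1_comp R (@sin R) ( *%R n.+1%:R) x _ _ (is_derive_sin _) lin.
    by rewrite [X in is_derive _ _ _ X]mulrC.
  by rewrite /GRing.scale /= mulKf.
rewrite /avg /Rintegral (@continuous_FTC2 R _ F).
- rewrite /= /F mulrN sinN sin_natpi /= mulr0 oppr0 !mulr0.
  by rewrite subr0 mulr0.
- by have := @pi_gt0 R; lra.
- exact: continuous_subspaceT (@continuous_cosM _).
- have cF : continuous F.
    by move=> x; apply: differentiable_continuous; apply/derivable1_diffP; case: (dF x).
  split.
  + by move=> x _; case: (dF x).
  + exact/cvg_at_right_filter/cF.
  + exact/cvg_at_left_filter/cF.
- by move=> x _; rewrite derive1E; apply: derive_val.
Qed.

Lemma cosM_cos (x y : R) : cos x * cos y = 2^-1 * (cos (x + y) + cos (x - y)).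
Proof. by rewrite cosD cosB; field. Qed.

(** Frequencies stay natural numbers: as cosine is even, a difference of frequencies may be replaced
    by their distance. *)
Lemma cos_distn (i j : nat) (x : R) :
  cos (`|i%:Z - j%:Z|%N%:R * x) = cos (i%:R * x - j%:R * x).
Proof.
rewrite -mulrBl; have [ij|/ltnW ij] := leqP i j.
  by rewrite distnC distnEl // natrB // -opprB mulNr cosN.
by rewrite distnEl // natrB.
Qed.

End Average.

(** * Cosine amplitudes *)

Section UniformConvergence.
Context {R : realType}.
Implicit Types (u v : nat -> R) (f : R -> R).

Lemma lim_le_bound u (l b : R) : u @ \oo --> l -> (forall n, u n <= b) -> l <= b.
Proof.
move=> ul ub; apply: (@ler_cvg_to nat \oo _ R u (fun _ => b)) ul _ _.
  exact: cvg_cst.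
by near=> n; exact: ub.
Unshelve. all: by end_near. Qed.

Lemma lim_dist_bound u (l a b : R) (N : nat) : u @ \oo --> l ->
  (forall n, (N <= n)%N -> `|u n - a| <= b) -> `|l - a| <= b.
Proof.
move=> ul ub; apply: (@ler_cvg_to nat \oo _ R (fun n => `|u n - a|) (fun _ => b)).
- exact: (cvg_norm (cvgB ul (cvg_cst a))).
- exact: cvg_cst.
by near=> n; apply: ub; near: n; exact: nbhs_infty_ge.
Unshelve. all: by end_near. Qed.

Lemma cvg_dist0 u v (l : R) : v @ \oo --> (0 : R) ->
  (forall n, `|u n - l| <= v n) -> u @ \oo --> l.
Proof.
move=> v0 uv; apply/cvgrPdist_le => e e0.
have /cvgrPdist_le/(_ _ e0) := v0; apply: filterS => n.
rewrite sub0r normrN => h; rewrite distrC; apply: le_trans (uv n) _.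
by apply: le_trans h; exact: ler_norm.
Qed.

(** An explicit error sequence, instead of a threshold for each epsilon, lets error bounds be
    combined by the arithmetic of limits. *)
Definition uniformly_to (F : nat -> R -> R) f :=
  exists2 e : nat -> R, e @ \oo --> (0 : R) & forall N x, `|F N x - f x| <= e N.

Lemma uniformly_to_cvg F f x : uniformly_to F f -> F ^~ x @ \oo --> f x.
Proof. by case=> e e0 Fe; apply: cvg_dist0 e0 _ => n; exact: Fe. Qed.

Lemma uniformly_to_continuous F f : uniformly_to F f ->
  (forall N, continuous (F N)) -> continuous f.
Proof.
case=> e e0 Fe cF x; apply/cvgrPdist_lt => d d0.
have d30 : 0 < d / 3 by lra.
have /cvgrPdist_lt/(_ _ d30)[N _ /(_ N (leqnn N))] := e0.
rewrite /= sub0r normrN => eN.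
have /cvgrPdist_lt/(_ _ d30) := cF N x; apply: filterS => y h.
have h1 := le_lt_trans (Fe N x) (le_lt_trans (ler_norm _) eN).
have h2 := le_lt_trans (Fe N y) (le_lt_trans (ler_norm _) eN).
rewrite (_ : f x - f y = (f x - F N x) + ((F N x - F N y) + (F N y - f y))); last by ring.
rewrite distrC in h1.
apply: (le_lt_trans (ler_normD _ _)).
have := ler_normD (F N x - F N y) (F N y - f y); lra.
Qed.

Lemma bounded_series_cvg u (B : R) : (forall n, 0 <= u n) ->
  (forall N, series u N <= B) ->
  [/\ cvgn (series u), limn (series u) <= B &
      forall N, series u N <= limn (series u)].
Proof.
move=> u0 uB.
have nd : nondecreasing_seq (series u) by apply: nondecreasing_series => n _ _.
have cu : cvgn (series u).
  apply: nondecreasing_is_cvgn => //.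
  by exists B => _ [n _ <-].
split=> //; first exact: lim_le_bound cu uB.
exact: nondecreasing_cvgn_le.
Qed.

Lemma series_subB u (M N : nat) : (N <= M)%N ->
  series u M - series u N = \sum_(N <= i < M) u i.
Proof. by move=> NM; rewrite sub_series_geq. Qed.

(** The error bound is a tail of [v] and does not involve [u]: applied at every point, it becomes
    the uniform error of the Weierstrass test. *)
Lemma dominated_series_cvg u v (B : R) : (forall n, `|u n| <= v n) ->
  (forall N, series v N <= B) ->
  [/\ cvgn (series u), `|limn (series u)| <= B &
      forall N, `|series u N - limn (series u)| <= limn (series v) - series v N].
Proof.
move=> uv vB.
have v0 n : 0 <= v n by apply: le_trans (uv n).
have [cv vlB vle] := bounded_series_cvg v0 vB.
have cu : cvgn (series u).
  apply: normed_cvg; apply: series_le_cvg cv => // n; exact: normr_ge0.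
have tail M N : (N <= M)%N -> `|series u M - series u N| <= series v M - series v N.
  move=> NM; rewrite !series_subB //; apply: le_trans (ler_norm_sum _ _ _) _.
  exact: ler_sum.
split=> //.
  rewrite -[limn (series u)]subr0; apply: (lim_dist_bound (N := 0%N) cu) => n _.
  have s0 (w : nat -> R) : series w 0%N = 0 by rewrite /series /= big_geq.
  rewrite subr0; have := tail n 0%N (leq0n _); rewrite !s0 !subr0.
  by move=> h; apply: le_trans h (vB n).
move=> N; rewrite distrC; apply: (lim_dist_bound (N := N) cu) => M NM.
by apply: le_trans (tail _ _ NM) _; rewrite lerD2r vle.
Qed.

Lemma weierstrass_M_test (g : nat -> R -> R) v (B : R) :
  (forall n x, `|g n x| <= v n) -> (forall N, series v N <= B) ->
  uniformly_to (fun N x => series (g ^~ x) N) (fun x => limn (series (g ^~ x))).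
Proof.
move=> gv vB; exists (fun N => limn (series v) - series v N).
  have v0 n : 0 <= v n by apply: le_trans (gv n 0).
  have [cv _ _] := bounded_series_cvg v0 vB.
  by rewrite -(subrr (limn (series v))); apply: cvgB => //; exact: cvg_cst.
by move=> N x; have [_ _] := dominated_series_cvg (gv^~ x) vB; exact.
Qed.

End UniformConvergence.

(** * Amplitudes and weighted Wiener bounds *)

Section Amplitudes.
Context {R : realType}.
Implicit Types (f g : R -> R) (n : nat).

Definition even_periodic f : Prop :=
  [/\ continuous f, forall x, f (x + 2 * pi) = f x & forall x, f (- x) = f x].

(* The coefficient of cos (n x) in the cosine series of f. *)
Definition amp f n : R :=
  (if n == 0%N then 1 else 2) * avg (fun x => f x * cos (n%:R * x)).

Definition wbound (p : nat) f (B : R) : Prop :=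
  forall N, \sum_(0 <= n < N) `|amp f n| * n.+1%:R ^+ p <= B.

Lemma even_periodicD f g : even_periodic f -> even_periodic g ->
  even_periodic (fun x => f x + g x).
Proof.
move=> [cf pf ef] [cg pg eg]; split; first exact: continuous_funD.
  by move=> x; rewrite pf pg.
by move=> x; rewrite ef eg.
Qed.

Lemma even_periodicM f g : even_periodic f -> even_periodic g ->
  even_periodic (fun x => f x * g x).
Proof.
move=> [cf pf ef] [cg pg eg]; split; first exact: continuous_funM.
  by move=> x; rewrite pf pg.
by move=> x; rewrite ef eg.
Qed.

Lemma even_periodicZ (a : R) f : even_periodic f ->
  even_periodic (fun x => a * f x).
Proof.
move=> [cf pf ef]; split; first by apply: continuous_funM => //; exact: continuous_fun_cst.
  by move=> x; rewrite pf.
by move=> x; rewrite ef.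
Qed.

Lemma even_periodic_cos n : even_periodic (fun x => cos (n%:R * x)).
Proof.
split; first exact: continuous_cosM.
  move=> x; rewrite mulrDr.
  have -> : n%:R * (2 * pi) = (pi *+ 2) *+ n :> R by rewrite !mulr_natl.
  exact: periodicn (@cosD2pi R) n _.
by move=> x; rewrite mulrN cosN.
Qed.

Lemma even_periodic_series (F : nat -> R -> R) N :
  (forall n, even_periodic (F n)) -> even_periodic (fun x => series (F ^~ x) N).
Proof.
move=> eF; split.
- by apply: continuous_fun_sum => i; case: (eF i).
- by move=> x; apply: eq_bigr => i _; case: (eF i).
- by move=> x; apply: eq_bigr => i _; case: (eF i).
Qed.

Lemma even_periodic_lim (F : nat -> R -> R) f : uniformly_to F f ->
  (forall n, even_periodic (F n)) -> even_periodic f.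
Proof.
move=> Ff eF.
have E y : limn (F ^~ y) = f y := cvg_lim (@Rhausdorff R) (uniformly_to_cvg Ff).
split.
- by apply: uniformly_to_continuous Ff _ => n; case: (eF n).
- move=> x; rewrite -!E; congr (limn _).
  by apply/funext => n; case: (eF n).
- move=> x; rewrite -!E; congr (limn _).
  by apply/funext => n; case: (eF n).
Qed.

Lemma ampD f g n : continuous f -> continuous g ->
  amp (fun x => f x + g x) n = amp f n + amp g n.
Proof.
move=> cf cg; rewrite /amp -mulrDr -avgD; last 2 first.
- exact: continuous_funM (@continuous_cosM _ _).
- exact: continuous_funM (@continuous_cosM _ _).
by congr (_ * avg _); apply/funext => x; rewrite mulrDl.
Qed.

Lemma ampZ (a : R) f n : continuous f -> amp (fun x => a * f x) n = a * amp f n.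
Proof.
move=> cf; rewrite /amp [RHS]mulrCA -(avgZ a); last exact: continuous_funM (@continuous_cosM _ _).
by congr (_ * avg _); apply/funext => x; rewrite mulrA.
Qed.

Lemma ampB f g n : continuous f -> continuous g ->
  amp (fun x => f x - g x) n = amp f n - amp g n.
Proof.
move=> cf cg; rewrite -[- amp g n]mulN1r -ampZ // -ampD //; last first.
  by apply: continuous_funM => //; exact: continuous_fun_cst.
by congr amp; apply/funext => x; rewrite mulN1r.
Qed.

Lemma amp_sum (I : Type) (r : seq I) (P : pred I) (F : I -> R -> R) n :
  (forall i, continuous (F i)) ->
  amp (fun x => \sum_(i <- r | P i) F i x) n = \sum_(i <- r | P i) amp (F i) n.
Proof.
move=> cF; rewrite /amp -mulr_sumr -avg_sum.
  by congr (_ * avg _); apply/funext => x; rewrite mulr_suml.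
by move=> i; exact: continuous_funM (@continuous_cosM _ _).
Qed.

Lemma amp_cos (m n : nat) : amp (fun x => cos (m%:R * x)) n = (m == n)%:R.
Proof.
rewrite /amp.
rewrite (_ : (fun x => _) = (fun x => 2^-1 * (cos ((m + n)%N%:R * x) +
    cos (`|m%:Z - n%:Z|%N%:R * x)))); last first.
  by apply/funext => x; rewrite cosM_cos cos_distn natrD mulrDl.
have cc k : continuous (fun x : R => cos (k%:R * x)) by exact: continuous_cosM.
rewrite avgZ; last exact: continuous_funD.
rewrite avgD // !avg_cos addn_eq0 distn_eq0.
have [->|n0] := eqVneq n 0%N.
  by rewrite andbT mul1r -mulr2n -[X in _ * X]mulr_natl mulKf // pnatr_eq0.
by rewrite andbF add0r mulVKf // pnatr_eq0.
Qed.

Lemma norm_amp_le f n (B : R) : continuous f -> (forall x, `|f x| <= B) ->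
  `|amp f n| <= 2 * B.
Proof.
move=> cf fB; rewrite /amp normrM.
have B0 : 0 <= B by apply: le_trans (fB 0).
apply: ler_pM => //; first by case: ifP => _; rewrite ger0_norm; lra.
apply: norm_avg_le => [|x]; first exact: continuous_funM (@continuous_cosM _ _).
rewrite normrM -[B]mulr1; apply: ler_pM => //; exact: cos_max.
Qed.

Lemma uniformly_to_amp F f n : uniformly_to F f ->
  (forall N, continuous (F N)) -> (fun N => amp (F N) n) @ \oo --> amp f n.
Proof.
move=> Ff cF; have cf := uniformly_to_continuous Ff cF.
case: Ff => e e0 Fe.
apply: (@cvg_dist0 _ _ (fun N => 2 * e N)).
  by rewrite -(mulr0 2); apply: cvgM => //; exact: cvg_cst.
move=> N; rewrite -ampB //; apply: norm_amp_le => //.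
exact: continuous_funB.
Qed.

Lemma wboundW p f (B : R) : wbound p f B -> wbound 0 f B.
Proof.
move=> h N; apply: le_trans (h N); apply: ler_sum => n _.
rewrite expr0 ler_wpM2l // exprn_ege1 // ler1n //.
Qed.

Lemma wbound_ge0 p f (B : R) : wbound p f B -> 0 <= B.
Proof. by move=> /(_ 0%N); rewrite big_geq. Qed.

Lemma wbound_le p f (B C : R) : B <= C -> wbound p f B -> wbound p f C.
Proof. by move=> BC h N; apply: le_trans (h N) BC. Qed.

Lemma wbound_amp p f (B : R) n : wbound p f B -> `|amp f n| <= B.
Proof.
move=> /wboundW/(_ n.+1); apply: le_trans.
by rewrite big_nat_recr //= expr0 mulr1 lerDr sumr_ge0 // => i _; rewrite mulr_ge0.
Qed.

Lemma wboundD p f g (B C : R) : continuous f -> continuous g ->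
  wbound p f B -> wbound p g C -> wbound p (fun x => f x + g x) (B + C).
Proof.
move=> cf cg fB gC N; apply: le_trans (lerD (fB N) (gC N)).
rewrite -big_split /=; apply: ler_sum => n _.
by rewrite ampD // -mulrDl ler_wpM2r // ?exprn_ge0 // ler_normD.
Qed.

Lemma wboundZ p (a : R) f (B : R) : continuous f ->
  wbound p f B -> wbound p (fun x => a * f x) (`|a| * B).
Proof.
move=> cf fB N; under eq_bigr do rewrite ampZ // normrM -mulrA.
by rewrite -mulr_sumr ler_wpM2l // fB.
Qed.

(** Lower semicontinuity: a partial sum involves finitely many amplitudes, so a common bound passes
    to the limit without convergence in norm. *)
Lemma wbound_lim p F f (B : R) : (forall n, (fun N => amp (F N) n) @ \oo --> amp f n) ->
  (forall N, wbound p (F N) B) -> wbound p f B.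
Proof.
move=> Ff FB N.
apply: (@lim_le_bound _ (fun M => \sum_(0 <= n < N) `|amp (F M) n| * n.+1%:R ^+ p)).
  apply: (cvg_big (op := +%R)) => [|n _]; first by exact: add_continuous.
  by apply: cvgM; [apply: cvg_norm; exact: Ff|exact: cvg_cst].
by move=> M; exact: FB.
Qed.

End Amplitudes.

(** * Uniqueness of Fourier series *)

Section FourierUniqueness.
Context {R : realType}.
Implicit Types (f g : R -> R) (n : nat).

(** Multiplication by cos x turns frequency n into n + 1 and |n - 1|, so by induction on the power
    of cos x the function stays orthogonal to every product cos(x)^i cos(nx). Polynomials in cos x
    are the case n = 0. *)
Lemma avg_poly_cos f (p : {poly R}) : continuous f ->
  (forall n, avg (fun x => f x * cos (n%:R * x)) = 0) ->
  avg (fun x => f x * p.[cos x]) = 0.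
Proof.
move=> cf f0.
have ccos : continuous (@cos R) by exact: continuous_cos.
have cX (k : nat) : continuous (fun x : R => cos x ^+ k) by exact: continuous_funX.
have H k : forall n, avg (fun x => f x * (cos x ^+ k * cos (n%:R * x))) = 0.
  elim: k => [|k IH] n; first by under eq_fun do rewrite expr0 mul1r.
  have cI m : continuous (fun x => f x * (cos x ^+ k * cos (m%:R * x))).
    apply: continuous_funM => //; apply: continuous_funM => //.
    exact: continuous_cosM.
  rewrite (_ : (fun x => _) = (fun x => 2^-1 * (
      f x * (cos x ^+ k * cos (n.+1%:R * x)) +
      f x * (cos x ^+ k * cos (`|1%:Z - n%:Z|%N%:R * x))))); last first.
    apply/funext => x; rewrite exprSr -mulrA cosM_cos cos_distn mul1r.
    have -> : n.+1%:R * x = x + n%:R * x by rewrite mulrS mulrDl mul1r.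
    by ring.
  rewrite avgZ; last exact: continuous_funD.
  by rewrite avgD // !IH // addr0 mulr0.
have -> : (fun x => f x * p.[cos x]) =
    (fun x => \sum_(i < size p) p`_i * (f x * (cos x ^+ i * cos (0%:R * x)))).
  apply/funext => x; rewrite horner_coef mulr_sumr; apply: eq_bigr => i _.
  by rewrite mul0r cos0 mulr1 mulrCA.
have cI k : continuous (fun x => f x * (cos x ^+ k * cos (0%:R * x))).
  apply: continuous_funM => //; apply: continuous_funM => //.
  exact: continuous_cosM.
rewrite avg_sum => [|i].
  by apply: big1 => i _; rewrite avgZ // H mulr0.
by apply: continuous_funM => //; exact: continuous_fun_cst.
Qed.

Lemma bernoulli_ineq (t : R) n : -1 <= t -> 1 + n%:R * t <= (1 + t) ^+ n.
Proof.
move=> t1; elim: n => [|n IH]; first by rewrite expr0 mul0r addr0.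
rewrite exprS; apply: (@le_trans _ _ ((1 + t) * (1 + n%:R * t))).
  rewrite -natr1; have : 0 <= n%:R * t ^+ 2 by rewrite mulr_ge0 // sqr_ge0.
  by nra.
by apply: ler_wpM2l => //; lra.
Qed.

Lemma continuous_near f (x0 e : R) : continuous f -> 0 < e ->
  exists2 d, 0 < d & forall x, `|x - x0| < d -> `|f x - f x0| < e.
Proof.
move=> cf e0; have /cvgrPdist_lt/(_ _ e0)/nbhs_ballP[d /= d0 H] := cf x0.
exists d => // x xd; rewrite distrC; apply: H.
by rewrite /ball /= distrC.
Qed.

(* With T = 1 + (c^2 - (cos x - cos x0)^2) / 4, the powers T^N blow up where
   cos x is close to cos x0 and are at most 1 elsewhere, but f has mean zero
   against each of them. *)
Lemma cos_orthogonal_nonpos f (x0 : R) : even_periodic f ->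
  (forall n, avg (fun x => f x * cos (n%:R * x)) = 0) ->
  0 < x0 < pi -> ~ 0 < f x0.
Proof.
move=> [cf _ ef] f0 /andP[x00 x0pi] fx0.
have pi_pos := @pi_gt0 R.
pose a := f x0 / 2; have a0 : 0 < a by rewrite /a; lra.
have [d1 d10 Hd1] := continuous_near x0 cf a0.
pose d := Num.min (d1 / 2) (Num.min (x0 / 2) ((pi - x0) / 2)).
have d0 : 0 < d by rewrite !lt_min; apply/and3P; split; lra.
have dd1 : d < d1 by apply: (@le_lt_trans _ _ (d1 / 2)); [rewrite ge_min lexx|lra].
have dx0 : d < x0.
  by apply: (@le_lt_trans _ _ (x0 / 2)); [rewrite !ge_min lexx orbT|lra].
have dpi : d < pi - x0.
  by apply: (@le_lt_trans _ _ ((pi - x0) / 2)); [rewrite !ge_min lexx !orbT|lra].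
pose y0 := cos x0.
pose c1 := cos (x0 - d) - y0; pose c2 := y0 - cos (x0 + d).
have c10 : 0 < c1.
  by rewrite /c1 subr_gt0 ltr_cos ?in_itv /=; [lra|lra|lra].
have c20 : 0 < c2.
  by rewrite /c2 subr_gt0 ltr_cos ?in_itv /=; [lra|lra|lra].
pose c := Num.min c1 c2.
have c0 : 0 < c by rewrite lt_min c10.
have cc1 : c <= c1 by rewrite ge_min lexx.
have cc2 : c <= c2 by rewrite ge_min lexx orbT.
(* Cosine decreases on [0, pi], so a value of [cos x] within [c] of [cos x0] puts [|x|] so near to
   [x0] that [f] is at least [a]. *)
have fa x : `|x| <= pi -> (cos x - y0) ^+ 2 < c ^+ 2 -> a <= f x.
  move=> xpi; rewrite -(cos_norm x); have <- : f `|x| = f x.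
    by case: (ger0P x) => // _; rewrite ef.
  move: (normr_ge0 x) xpi; set z := `|x| => z0 zpi hz.
  have {}hz : `|cos z - y0| < c.
    by rewrite -ltr_sqr ?nnegrE ?(ltW c0) // real_normK ?num_real.
  have zd : `|z - x0| < d1.
    rewrite ltr_norml; apply/andP; split; rewrite ltNge; apply/negP => h.
      have : cos (x0 - d) <= cos z.
        by rewrite leNgt ltr_cos ?in_itv /= -?leNgt; [lra|lra|lra].
      by move: hz; rewrite ltr_norml => /andP[_]; rewrite /c1 in cc1; lra.
    have : cos z <= cos (x0 + d).
      by rewrite leNgt ltr_cos ?in_itv /= -?leNgt; [lra|lra|lra].
    by move: hz; rewrite ltr_norml => /andP[+ _]; rewrite /c2 in cc2; lra.
  by have := Hd1 _ zd; rewrite ltr_norml => /andP[+ _]; rewrite /a; lra.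
(* Division by 4 ensures [-1 <= g], because two cosines differ by at most 2; hence [1 + g] lies in
   [0, 1] wherever [g <= 0]. *)
pose g x : R := (c ^+ 2 - (cos x - y0) ^+ 2) / 4.
have cg : continuous g.
  apply: continuous_funM; last exact: continuous_fun_cst.
  apply: continuous_funB; first exact: continuous_fun_cst.
  apply: continuous_funX; apply: continuous_funB; last exact: continuous_fun_cst.
  exact: continuous_cos.
have cng : continuous (fun x => `|g x|).
  by move=> x; apply: cvg_norm; exact: cg.
have gN1 x : -1 <= g x.
  rewrite /g; have := cos_le1 x; have := cos_geN1 x.
  have := cos_le1 x0; have := cos_geN1 x0; rewrite -/y0 => h1 h2 h3 h4.
  have : (cos x - y0) ^+ 2 <= 4 by nra.
  have : 0 <= c ^+ 2 by exact: sqr_ge0.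
  lra.
have [B fB] : exists B, forall x, `|x| <= pi -> `|f x| <= B.
  have cnf : continuous (fun x => `|f x|) by move=> x; apply: cvg_norm; exact: cf.
  have Npipi : - pi <= pi :> R by lra.
  have [y _ hy] := EVT_max Npipi (continuous_subspaceT cnf).
  by exists `|f y| => x xpi; apply: hy; rewrite in_itv /= -ler_norml.
have B0 : 0 <= B by apply: le_trans (fB 0 _); rewrite ?normr0 // ltW.
pose P x := g x + `|g x|.
have cP : continuous P by exact: continuous_funD.
have A0 : 0 < avg P.
  have c20' : 0 < c ^+ 2 / 8 by rewrite divr_gt0 // exprn_gt0.
  have [d2 d20 Hd2] := continuous_near x0 cg c20'.
  pose d' := Num.min (d2 / 2) d.
  have d'd : d' <= d by rewrite ge_min lexx orbT.
  have d'd2 : d' < d2 by apply: (@le_lt_trans _ _ (d2 / 2)); [rewrite ge_min lexx|lra].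
  apply: (@avg_gt0 _ _ x0 d' (c ^+ 2 / 8)) => //; try lra.
  - by rewrite lt_min d0 andbT; lra.
  - by move=> x; rewrite /P; have := ler_norm (- g x); rewrite normrN; lra.
  move=> x xd; have := Hd2 x (le_lt_trans xd d'd2).
  rewrite {2}/g subrr expr0n /= subr0 ltr_norml => /andP[h _].
  by rewrite /P; have := normr_ge0 (g x); lra.
(* Pointwise, a N P / 2 - B <= f (1 + g)^N: where g > 0, P = 2 g and Bernoulli's inequality applies;
   elsewhere P = 0 and the power is at most 1. The right-hand side has mean zero, and N is
   arbitrary. *)
have key N : a * N%:R / 2 * avg P - B <= 0.
  pose T : {poly R} := (1 + c ^+ 2 / 4)%:P - (4^-1)%:P * ('X - y0%:P) ^+ 2.
  have TE x : T.[cos x] = 1 + g x.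
    by rewrite /T hornerD hornerN hornerM horner_exp hornerD hornerN hornerX !hornerC /g; field.
  have h0 := avg_poly_cos (T ^+ N) cf f0.
  rewrite -h0 -(avgZ _ cP) -[X in _ - X](avg_cst B) -avgB; last 2 first.
  - by apply: continuous_funM => //; exact: continuous_fun_cst.
  - exact: continuous_fun_cst.
  apply: le_avg => [||x xpi].
  - apply: continuous_funB; last exact: continuous_fun_cst.
    by apply: continuous_funM => //; exact: continuous_fun_cst.
  - under eq_fun do rewrite horner_exp TE.
    apply: continuous_funM => //; apply: continuous_funX.
    by apply: continuous_funD => //; exact: continuous_fun_cst.
  rewrite horner_exp TE; have [gpos|gneg] := ltP 0 (g x).
    have fx : a <= f x by apply: fa => //; move: gpos; rewrite /g; lra.
    have P2 : P x = 2 * g x by rewrite /P gtr0_norm //; ring.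
    have bern := bernoulli_ineq N (gN1 x).
    have Ng : 0 <= N%:R * g x by rewrite mulr_ge0 // ltW.
    have : a * (N%:R * g x) <= f x * (1 + g x) ^+ N.
      by apply: ler_pM => //; [lra|lra].
    by rewrite P2; lra.
  have P2 : P x = 0 by rewrite /P ler0_norm //; ring.
  rewrite P2 mulr0 sub0r.
  have : `|f x * (1 + g x) ^+ N| <= B.
    rewrite normrM -[B]mulr1; apply: ler_pM => //; first exact: fB.
    rewrite normrX exprn_ile1 // ger0_norm; have := gN1 x; lra.
  by rewrite ler_norml => /andP[].
have [N HN] : exists N : nat, B / (a / 2 * avg P) < N%:R.
  exists (Num.bound (B / (a / 2 * avg P))); 
  rewrite archi_boundP // divr_ge0 // mulr_ge0 //; lra.
have aP : 0 < a / 2 * avg P by rewrite mulr_gt0 //; lra.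
move: HN; rewrite ltr_pdivrMr //; have := key N; lra.
Qed.

Lemma periodic_int f (x : R) (m : int) : (forall x, f (x + 2 * pi) = f x) ->
  f (x + 2 * pi * m%:~R) = f x.
Proof.
move=> pf; have pn (n : nat) y : f (y + 2 * pi * n%:R) = f y.
  elim: n => [|n IH]; first by rewrite mulr0 addr0.
  have -> : n.+1%:R = n%:R + 1 :> R by rewrite natr1.
  by rewrite mulrDr mulr1 addrA pf.
case: m => n; first exact: pn.
by rewrite NegzE mulrNz mulrN -[LHS](pn n.+1) subrK.
Qed.

Lemma even_periodic_reduce f (x : R) : even_periodic f ->
  exists2 y, 0 <= y <= pi & f x = f y.
Proof.
move=> [_ pf ef]; have pi_pos := @pi_gt0 R.
pose m := Num.floor ((x + pi) / (2 * pi)).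
have p0 : 0 < 2 * pi :> R by lra.
have /andP[h1 h2] := floor_itv ((x + pi) / (2 * pi)).
pose z := x - 2 * pi * m%:~R.
have xz : f x = f z by rewrite -[RHS](periodic_int z m pf) /z subrK.
have zpi : `|z| <= pi.
  move: h1 h2; rewrite -/m ler_pdivlMr // ltr_pdivrMr // rmorphD /= => h1 h2.
  by rewrite ler_norml /z; apply/andP; split; lra.
exists `|z|; first by rewrite normr_ge0.
by rewrite xz; case: (ger0P z) => // _; rewrite ef.
Qed.

(** The sign argument, applied to [f] and to its opposite, works at interior points of [0, pi]; the
    end points follow by continuity, the rest of the line by evenness and periodicity. *)
Lemma even_periodic_amp0 f : even_periodic f -> (forall n, amp f n = 0) ->
  forall x, f x = 0.
Proof.
move=> epf f0 x; have [cf pf ef] := epf.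
have pi_pos := @pi_gt0 R.
have f0' n : avg (fun x => f x * cos (n%:R * x)) = 0.
  have /eqP := f0 n; rewrite /amp mulf_eq0 => /orP[|/eqP//].
  by case: ifP; rewrite ?oner_eq0 ?pnatr_eq0.
have inside z : 0 < z < pi -> f z = 0.
  move=> hz; apply/eqP; rewrite eq_le; apply/andP; split; rewrite leNgt; apply/negP.
    exact: cos_orthogonal_nonpos.
  move=> fz; have ep' := even_periodicZ (-1) epf.
  apply: (cos_orthogonal_nonpos ep' _ hz); last by rewrite mulN1r oppr_gt0.
  move=> n; under eq_fun do rewrite -mulrA; rewrite avgZ ?f0' ?mulr0 //.
  by apply: continuous_funM => //; exact: continuous_cosM.
have [y hy ->] := even_periodic_reduce x epf.
apply/eqP/negPn/negP => fy.
have fy0 : 0 < `|f y| by rewrite normr_gt0.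
have [d d0 Hd] := continuous_near y cf fy0.
pose e := Num.min (d / 2) (pi / 4).
have e0 : 0 < e by rewrite lt_min; apply/andP; split; lra.
have ed : e < d by apply: (@le_lt_trans _ _ (d / 2)); [rewrite ge_min lexx|lra].
have epi : e <= pi / 4 by rewrite ge_min lexx orbT.
case/andP: hy => y0 ypi.
suff [z hz zd] : exists2 z, 0 < z < pi & `|z - y| < d.
  by have := Hd z zd; rewrite inside // sub0r normrN ltxx.
have [yl|yr] := ltP y (pi / 2).
  exists (y + e); first by apply/andP; split; lra.
  by rewrite addrAC subrr add0r gtr0_norm.
exists (y - e); first by apply/andP; split; lra.
by rewrite addrAC subrr sub0r normrN gtr0_norm.
Qed.

Lemma even_periodic_amp_inj f g : even_periodic f -> even_periodic g ->
  amp f =1 amp g -> f = g.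
Proof.
move=> epf epg fg; apply/funext => x.
have := even_periodic_amp0 (even_periodicD epf (even_periodicZ (-1) epg)).
have [cf _ _] := epf; have [cg _ _] := epg.
have cg' : continuous (fun x => -1 * g x).
  by apply: continuous_funM => //; exact: continuous_fun_cst.
move=> /(_ _ x) H; apply/eqP; rewrite -subr_eq0 -mulN1r H // => n.
by rewrite ampD // ampZ // fg mulN1r subrr.
Qed.

(** The M-test makes the cosine series converge uniformly to a function with the amplitudes of [f];
    injectivity of the amplitudes identifies the two. *)
Lemma fourier_series_uniform f (B : R) : even_periodic f -> wbound 0 f B ->
  uniformly_to (fun N x => \sum_(0 <= n < N) amp f n * cos (n%:R * x)) f /\
  forall x, `|f x| <= B.
Proof.
move=> epf fB.
pose g n x : R := amp f n * cos (n%:R * x).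
have gv n x : `|g n x| <= `|amp f n|.
  by rewrite normrM ler_piMr // cos_max.
have vB N : series (fun n => `|amp f n|) N <= B.
  by apply: le_trans (fB N); rewrite /series /=; under [leRHS]eq_bigr do rewrite expr0 mulr1.
have U := weierstrass_M_test gv vB.
have epS N : even_periodic (fun x => series (g ^~ x) N).
  by apply: even_periodic_series => n; apply: even_periodicZ; exact: even_periodic_cos.
have cS N : continuous (fun x => series (g ^~ x) N) by case: (epS N).
have epl := even_periodic_lim U epS.
suff E : f = (fun x => limn (series (g ^~ x))).
  split; first by rewrite {2}E.
  by move=> x; rewrite E; case: (dominated_series_cvg (gv ^~ x) vB).
apply: even_periodic_amp_inj => // m.
apply/esym; rewrite -(cvg_lim (@Rhausdorff R) (uniformly_to_amp U cS)).
apply: (@lim_near_cst R _ _ _ _ (amp f m)); first exact: Rhausdorff.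
near=> N; rewrite /series /= amp_sum; last first.
  by move=> i; apply: continuous_funM; [exact: continuous_fun_cst|exact: continuous_cosM].
have aE i : amp (g i) m = amp f i * (i == m)%:R.
  by rewrite ampZ ?amp_cos //; exact: continuous_cosM.
under eq_bigr do rewrite aE.
have mN : (m < N)%N by near: N; exact: nbhs_infty_gt.
rewrite (bigD1_seq m) ?iota_uniq ?mem_index_iota //= eqxx mulr1 big1 ?addr0 // => i im.
by rewrite (negbTE im) mulr0.
Unshelve. all: by end_near. Qed.

Lemma wbound_sup p f (B : R) : even_periodic f -> wbound p f B ->
  forall x, `|f x| <= B.
Proof. by move=> epf /wboundW fB; case: (fourier_series_uniform epf fB). Qed.

(** Completeness of the weighted algebra in usable form: a series with summable bounds may be
    summed, bounded and expanded term by term. It serves both the operator and the power series in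
    t. *)
Lemma superposition p (F : nat -> R -> R) v (B : R) :
  (forall n, even_periodic (F n)) -> (forall n, wbound p (F n) (v n)) ->
  (forall N, series v N <= B) ->
  [/\ uniformly_to (fun N x => series (F ^~ x) N) (fun x => limn (series (F ^~ x))),
      even_periodic (fun x => limn (series (F ^~ x))),
      wbound p (fun x => limn (series (F ^~ x))) B &
      forall n, series (fun m => amp (F m) n) @ \oo -->
        amp (fun x => limn (series (F ^~ x))) n].
Proof.
move=> epF Fv vB.
have U := weierstrass_M_test (fun n => wbound_sup (epF n) (Fv n)) vB.
have epS N : even_periodic (fun x => series (F ^~ x) N).
  exact: even_periodic_series.
have cS N : continuous (fun x => series (F ^~ x) N) by case: (epS N).
have ampS N n : amp (fun x => series (F ^~ x) N) n = series (fun m => amp (F m) n) N.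
  by rewrite /series /= amp_sum // => i; case: (epF i).
have L n : series (fun m => amp (F m) n) @ \oo -->
    amp (fun x => limn (series (F ^~ x))) n.
  have := uniformly_to_amp (n := n) U cS.
  by under eq_fun do rewrite ampS.
split=> //; first exact: even_periodic_lim U epS.
apply: (@wbound_lim _ _ (fun N x => series (F ^~ x) N)) => [n|N].
  exact: uniformly_to_amp.
move=> M; apply: le_trans (vB N); rewrite /series /=.
apply: (@le_trans _ _ (\sum_(0 <= m < N) \sum_(0 <= n < M) `|amp (F m) n| * n.+1%:R ^+ p)).
  rewrite exchange_big /=; apply: ler_sum => n _; rewrite -mulr_suml.
  rewrite ler_wpM2r ?exprn_ge0 //; have := ampS N n; rewrite /series /= => ->.
  exact: ler_norm_sum.
by apply: ler_sum => m _; exact: Fv.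
Qed.

End FourierUniqueness.

(** * Weighted Wiener algebras *)

Section CosinePolynomials.
Context {R : realType}.
Implicit Types (s : seq (R * nat)) (f g : R -> R) (p n : nat).

(** A cosine polynomial is an unsorted list of pairs (coefficient, frequency), in which a frequency
    may occur several times. *)
Definition ev s (x : R) : R := \sum_(a <- s) a.1 * cos (a.2%:R * x).

(** Repeated frequencies are not merged, so this only dominates the Wiener norm of [ev s]; in
    exchange it is additive under concatenation. *)
Definition tnorm p s : R := \sum_(a <- s) `|a.1| * a.2.+1%:R ^+ p.

Definition coefc s n : R := \sum_(a <- s | a.2 == n) a.1.

Definition tmul s1 s2 : seq (R * nat) :=
  [seq (2^-1 * (a.1 * b.1), (a.2 + b.2)%N) | a <- s1, b <- s2] ++
  [seq (2^-1 * (a.1 * b.1), `|a.2%:Z - b.2%:Z|%N) | a <- s1, b <- s2].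

Definition tmap (m : nat -> R) s : seq (R * nat) := [seq (m a.2 * a.1, a.2) | a <- s].

Lemma ev_tmul s1 s2 x : ev (tmul s1 s2) x = ev s1 x * ev s2 x.
Proof.
rewrite /ev /tmul big_cat /= !big_allpairs_dep /= -big_split /= mulr_suml.
apply: eq_bigr => a _; rewrite -big_split /= mulr_sumr; apply: eq_bigr => b _.
by rewrite cos_distn natrD mulrDl cosD cosB; field.
Qed.

Lemma ev_cat s1 s2 x : ev (s1 ++ s2) x = ev s1 x + ev s2 x.
Proof. by rewrite /ev big_cat. Qed.

Lemma even_periodic_ev s : even_periodic (ev s).
Proof.
have ep (a : R * nat) : even_periodic (fun x => a.1 * cos (a.2%:R * x)).
  by apply: even_periodicZ; exact: even_periodic_cos.
split.
- by apply: continuous_fun_sum => a; case: (ep a).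
- by move=> x; apply: eq_bigr => a _; case: (ep a).
- by move=> x; apply: eq_bigr => a _; case: (ep a).
Qed.

Lemma amp_ev s n : amp (ev s) n = coefc s n.
Proof.
have cc (a : R * nat) : continuous (fun x : R => a.1 * cos (a.2%:R * x)).
  by apply: continuous_funM; [exact: continuous_fun_cst|exact: continuous_cosM].
rewrite amp_sum // /coefc [RHS]big_mkcond; apply: eq_bigr => a _.
rewrite ampZ ?amp_cos; last exact: continuous_cosM.
by case: ifP => _; rewrite ?mulr1 ?mulr0.
Qed.

Lemma tnorm_ge0 p s : 0 <= tnorm p s.
Proof. by apply: sumr_ge0 => a _; rewrite mulr_ge0 ?exprn_ge0. Qed.

Lemma norm_coefc_le p s n : `|coefc s n| <= tnorm p s.
Proof.
apply: le_trans (ler_norm_sum _ _ _) _; rewrite big_mkcond /=; apply: ler_sum => a _.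
case: ifP => _; last by rewrite mulr_ge0 ?exprn_ge0.
by rewrite ler_peMr // exprn_ege1 // ler1n.
Qed.

Lemma wbound_ev p s : wbound p (ev s) (tnorm p s).
Proof.
move=> N; apply: (@le_trans _ _ (\sum_(0 <= n < N) \sum_(a <- s)
    (if a.2 == n then `|a.1| * a.2.+1%:R ^+ p else 0))).
  apply: ler_sum => n _; rewrite amp_ev -big_mkcond /=.
  apply: (@le_trans _ _ ((\sum_(a <- s | a.2 == n) `|a.1|) * n.+1%:R ^+ p)).
    by rewrite ler_wpM2r ?exprn_ge0 // ler_norm_sum.
  by rewrite mulr_suml; apply: ler_sum => a /eqP->.
rewrite exchange_big /=; apply: ler_sum => a _.
have a0 : 0 <= `|a.1| * a.2.+1%:R ^+ p by rewrite mulr_ge0 ?exprn_ge0.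
rewrite -big_mkcond /=; have [aN|Na] := ltnP a.2 N; last first.
  rewrite big_nat_cond big1 // => i /andP[/andP[_ iN] /eqP ai].
  by move: iN; rewrite -ai ltnNge Na.
rewrite big_mkcond /= (bigD1_seq a.2) ?iota_uniq ?mem_index_iota //= eqxx big1 ?addr0 //.
by move=> i; rewrite eq_sym => /negbTE ->.
Qed.

Lemma tnorm_cat p s1 s2 : tnorm p (s1 ++ s2) = tnorm p s1 + tnorm p s2.
Proof. by rewrite /tnorm big_cat. Qed.

Lemma tnorm_tmap p (m : nat -> R) (K : R) s : (forall n, `|m n| <= K) ->
  tnorm p (tmap m s) <= K * tnorm p s.
Proof.
move=> mK; rewrite /tnorm /tmap big_map mulr_sumr; apply: ler_sum => a _ /=.
by rewrite normrM -mulrA ler_wpM2r // mulr_ge0 ?exprn_ge0.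
Qed.

(** The weight is submultiplicative: every k <= a + b satisfies k + 1 <= (a + 1)(b + 1), and the sum
    and the distance of a and b are both such. *)
Lemma tnorm_tmul p s1 s2 : tnorm p (tmul s1 s2) <= tnorm p s1 * tnorm p s2.
Proof.
rewrite /tnorm /tmul big_cat /= !big_allpairs_dep /= -big_split /= mulr_suml.
apply: ler_sum => a _; rewrite -big_split /= mulr_sumr; apply: ler_sum => b _.
have W k : (k <= a.2 + b.2)%N ->
    (k.+1%:R : R) ^+ p <= a.2.+1%:R ^+ p * b.2.+1%:R ^+ p.
  move=> kab; rewrite -exprMn lerXn2r ?nnegrE ?mulr_ge0 // -natrM ler_nat.
  apply: (@leq_trans (a.2 + b.2).+1) => //.
  by rewrite mulSn mulnS addSn ltnS addnA [(b.2 + _)%N]addnC leq_addr.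
rewrite !normrM ger0_norm; last by rewrite invr_ge0.
have W1 := W _ (leqnn _).
have W2 : (`|a.2%:Z - b.2%:Z|%N.+1%:R : R) ^+ p <= a.2.+1%:R ^+ p * b.2.+1%:R ^+ p.
  apply: W; have [ab|/ltnW ab] := leqP a.2 b.2.
    by rewrite distnC distnEl //; apply: leq_trans (leq_subr _ _) (leq_addl _ _).
  by rewrite distnEl //; apply: leq_trans (leq_subr _ _) (leq_addr _ _).
have ab : 0 <= `|a.1| * `|b.1| by rewrite mulr_ge0.
move: W1 W2; set w := _ ^+ p * _ ^+ p => W1 W2.
have -> : `|a.1| * a.2.+1%:R ^+ p * (`|b.1| * b.2.+1%:R ^+ p) =
  2^-1 * (`|a.1| * `|b.1|) * w + 2^-1 * (`|a.1| * `|b.1|) * w by rewrite /w; field.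
by apply: lerD; rewrite ler_wpM2l // mulr_ge0 ?invr_ge0.
Qed.

Lemma coefc_cat s1 s2 n : coefc (s1 ++ s2) n = coefc s1 n + coefc s2 n.
Proof. by rewrite /coefc big_cat. Qed.

Lemma coefc_tmap (m : nat -> R) s n : coefc (tmap m s) n = m n * coefc s n.
Proof.
by rewrite /coefc /tmap big_map mulr_sumr /=; apply: eq_bigr => a /eqP ->.
Qed.

End CosinePolynomials.

Section WienerAlgebra.
Context {R : realType}.
Implicit Types (f g : R -> R) (p n : nat).

(* Partial Fourier sums are cosine polynomials of no larger norm, so the product
   estimate passes to the limit. *)
Lemma wboundM p f g (B C : R) : even_periodic f -> even_periodic g ->
  wbound p f B -> wbound p g C -> wbound p (fun x => f x * g x) (B * C).
Proof.
move=> epf epg fB gC.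
pose S (h : R -> R) N : seq (R * nat) := [seq (amp h n, n) | n <- index_iota 0 N].
have SE h N x : ev (S h N) x = \sum_(0 <= n < N) amp h n * cos (n%:R * x).
  by rewrite /ev big_map.
have Sn h D N : wbound p h D -> tnorm p (S h N) <= D.
  by move=> hD; rewrite /tnorm big_map; exact: hD.
have [Uf fle] := fourier_series_uniform epf (wboundW fB).
have [Ug gle] := fourier_series_uniform epg (wboundW gC).
have U : uniformly_to (fun N x => ev (tmul (S f N) (S g N)) x) (fun x => f x * g x).
  case: Uf Ug => e e0 fe [e' e'0 ge'].
  exists (fun N => e N * C + B * e' N).
    by have := cvgD (cvgM e0 (cvg_cst C)) (cvgM (cvg_cst B) e'0);
      rewrite mul0r mulr0 addr0; apply.
  move=> N x; rewrite ev_tmul !SE.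
  have := fe N x; have := ge' N x; have := fle x.
  have := wbound_sup (even_periodic_ev (S g N)) (@wbound_ev _ p (S g N)) x.
  rewrite SE => /le_trans/(_ (Sn _ _ N gC)).
  set F := \sum_(0 <= n < N) _; set G := \sum_(0 <= n < N) _ => h1 h2 h3 h4.
  have -> : G * F - f x * g x = (G - f x) * F + f x * (F - g x) by ring.
  apply: (le_trans (ler_normD _ _)); rewrite !normrM.
  by apply: lerD; apply: ler_pM.
apply: (@wbound_lim _ _ (fun N x => ev (tmul (S f N) (S g N)) x)) => [n|N].
  by apply: uniformly_to_amp U _ => N; case: (even_periodic_ev (tmul (S f N) (S g N))).
apply: wbound_le (@wbound_ev _ p _).
apply: le_trans (tnorm_tmul _ _ _) _.
by apply: ler_pM; rewrite ?tnorm_ge0 ?Sn.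
Qed.

End WienerAlgebra.

(** * Fourier multipliers on even functions *)

Section Multipliers.
Context {R : realType}.
Implicit Types (u m : R -> R) (n : nat).

(** The partition functions need not be even. The Fourier coefficients of an even function at n and
    -n agree, so a multiplier acts on cos(nx) through the even part of its symbol and adds i sin(nx)
    times the odd part. *)
Definition sym_even m n : R := (m n%:R + m (- n%:R)) / 2.
Definition sym_odd m n : R := (m n%:R - m (- n%:R)) / 2.

Lemma fourier_coef_even u (n : int) : even_periodic u ->
  fourier_coef u n = (avg (fun x => u x * cos (`|n|%N%:R * x)))%:C%C.
Proof.
move=> [cu _ eu]; rewrite /fourier_coef /= -/(avg (fun x => u x * cos (n%:~R * x))).
rewrite -/(avg (fun x => u x * sin (n%:~R * x))).
rewrite (@avg_odd _ (fun x => u x * sin _)); last 2 first.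
- by apply: continuous_funM => //; exact: continuous_sinM.
- by move=> x; rewrite mulrN sinN eu mulrN.
rewrite oppr0; congr (Complex (avg _) _); apply/funext => x.
by case: n => n //; rewrite NegzE abszN mulrNz mulNr cosN.
Qed.

Lemma sum_symmetric (V : zmodType) (F : int -> V) N :
  \sum_(0 <= j < N.*2.+1) F (j%:Z - N%:Z) =
  F 0 + \sum_(1 <= n < N.+1) (F n%:Z + F (- n%:Z)).
Proof.
elim: N => [|N IH]; first by rewrite big_nat1 subrr big_geq // addr0.
rewrite doubleS big_nat_recr //= big_nat_recl //= [X in _ = _ + X]big_nat_recr //=.
rewrite (eq_bigr (fun j => F (j%:Z - N%:Z))) => [|j _]; last first.
  by rewrite -addn1 -[N.+1]addn1 !PoszD opprD addrACA subrr addr0.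
have -> : N.*2.+2%:Z - N.+1%:Z = N.+1%:Z by rewrite -doubleS -addnn PoszD addrK.
by rewrite IH sub0r -!addrA addrC -!addrA.
Qed.

Lemma multiplier_sum_even m u x N : even_periodic u ->
  multiplier_sum m u x N =
  Complex (\sum_(0 <= n < N.+1) sym_even m n * amp u n * cos (n%:R * x))
          (\sum_(0 <= n < N.+1) sym_odd m n * amp u n * sin (n%:R * x)).
Proof.
move=> epu.
pose a n := avg (fun x => u x * cos (n%:R * x)).
pose F (n : int) : R[i] := (m n%:~R)%:C%C * fourier_coef u n * expi (n%:~R * x).
have FE (n : int) : F n = ((m n%:~R * a `|n|%N * cos (n%:~R * x)) +i*
                   (m n%:~R * a `|n|%N * sin (n%:~R * x)))%C.
  by rewrite /F fourier_coef_even // /expi; apply/eqP; rewrite eq_complex /=;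
    apply/andP; split; apply/eqP; rewrite -/(a _); ring.
have -> : multiplier_sum m u x N = \sum_(0 <= j < N.*2.+1) F (j%:Z - N%:Z) by [].
rewrite sum_symmetric.
have CS (G H : nat -> R) b c : Complex (\sum_(b <= n < c) G n) (\sum_(b <= n < c) H n) =
    \sum_(b <= n < c) (G n +i* H n)%C.
  by elim: (index_iota b c) => [|i r IH]; rewrite ?big_nil // !big_cons -IH.
rewrite CS [RHS]big_ltn //; congr (_ + _).
  rewrite FE /sym_even /sym_odd /amp eqxx !mul0r sin0 mulr0 mulr0 cos0 oppr0 /a /=.
  by congr Complex; field.
apply: eq_big_nat => n /andP[n1 _]; rewrite !FE /sym_even /sym_odd /amp gtn_eqF //.
rewrite abszN absz_nat mulrNz mulNr cosN sinN -/(a n).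
by apply/eqP; rewrite eq_complex /=; apply/andP; split; apply/eqP; field.
Qed.

Lemma multiplier_even m u x : even_periodic u ->
  multiplier m u x =
  (limn (fun N => \sum_(0 <= n < N.+1) sym_even m n * amp u n * cos (n%:R * x)) +i*
   limn (fun N => \sum_(0 <= n < N.+1) sym_odd m n * amp u n * sin (n%:R * x)))%C.
Proof.
by move=> epu; rewrite /multiplier; congr (limn _ +i* limn _)%C; apply/funext => N;
  rewrite multiplier_sum_even.
Qed.

(** The symmetric sum of index N includes mode N, hence runs over N + 1 amplitudes. *)
Lemma lim_series_shift1 (g : nat -> R) (l : R) : series g @ \oo --> l ->
  limn (fun N => \sum_(0 <= n < N.+1) g n) = l.
Proof.
move=> gl; apply: cvg_lim; first exact: Rhausdorff.
by move: gl; rewrite -(cvg_shiftS (series g)).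
Qed.

Lemma whitham_op_cvg (kappa T : R) u x (l : R) : even_periodic u ->
  series (fun n => scaled_symbol kappa T n%:R * amp u n * cos (n%:R * x)) @ \oo --> l ->
  whitham_op kappa T u x = l.
Proof.
move=> epu ul; rewrite /whitham_op multiplier_even //=.
rewrite -(lim_series_shift1 ul); congr (limn _); apply/funext => N.
apply: eq_bigr => n _; congr (_ * _ * _).
suff E : scaled_symbol kappa T (- n%:R) = scaled_symbol kappa T n%:R.
  by rewrite /sym_even E; field.
rewrite /scaled_symbol /whitham_symbol mulrN oppr_eq0; case: ifP => // _.
congr Num.sqrt; rewrite /tanh opprK sqrrN.
set a := expR _; set b := expR _.
have -> : (b - a) / (b + a) = - ((a - b) / (a + b)).
  by rewrite -mulNr opprB [a + b]addrC.
by rewrite !(mulrN, mulNr, invrN).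
Qed.

(** As [m] is nonnegative, its odd part is dominated by its even part, so [D] bounds both the real
    and the imaginary series; 2 is a crude substitute for the square root of 2. *)
Lemma normc_multiplier_le m u x (D : R) : even_periodic u -> (forall y, 0 <= m y) ->
  (forall N, \sum_(0 <= n < N) sym_even m n * `|amp u n| <= D) ->
  ComplexField.Normc.normc (multiplier m u x) <= 2 * D.
Proof.
move=> epu m0 mD; rewrite multiplier_even //=.
have sym_ge0 n : 0 <= sym_even m n by rewrite /sym_even; have := m0 n%:R; have := m0 (- n%:R); lra.
have sym_le n : `|sym_odd m n| <= sym_even m n.
  by rewrite /sym_even /sym_odd ler_norml; have := m0 n%:R; have := m0 (- n%:R); lra.
have bnd (c : nat -> R) (t : R -> R) : (forall n, `|c n| <= sym_even m n) ->
    (forall y, `|t y| <= 1) ->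
    `|limn (fun N => \sum_(0 <= n < N.+1) c n * amp u n * t (n%:R * x))| <= D.
  move=> ce t1; have H n : `|c n * amp u n * t (n%:R * x)| <= sym_even m n * `|amp u n|.
    rewrite !normrM -[leRHS]mulr1; by apply: ler_pM => //; rewrite ?mulr_ge0 // ler_wpM2r.
  have [cvs lD _] := dominated_series_cvg H mD.
  by rewrite (lim_series_shift1 cvs).
have sym_norm n : `|sym_even m n| <= sym_even m n by rewrite ger0_norm.
move: (bnd _ _ sym_norm (@cos_max R)) (bnd _ _ sym_le (@sin_max R)).
set A := limn _; set B := limn _ => hA hB.
have D0 : 0 <= D by apply: le_trans hA.
have hs : A ^+ 2 + B ^+ 2 <= (2 * D) ^+ 2.
  rewrite -(real_normK (num_real A)) -(real_normK (num_real B)).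
  have : `|A| ^+ 2 <= D ^+ 2 by rewrite lerXn2r ?nnegrE.
  have : `|B| ^+ 2 <= D ^+ 2 by rewrite lerXn2r ?nnegrE.
  by have := sqr_ge0 D; rewrite exprMn; lra.
rewrite -[leRHS]ger0_norm ?mulr_ge0 // -sqrtr_sqr.
exact: ler_wsqrtr.
Qed.

End Multipliers.

(** * Comparison with Zygmund norms *)

Section Zygmund.
Context {R : realType} (psi : nat -> R -> R).
Hypothesis hpsi : zygmund_partition psi.
Implicit Types (u : R -> R) (n j : nat) (s b : R).

Local Notation psq j := (fun x : R => psi j x ^+ 2).

Lemma psi_sq_le1 j x : psi j x ^+ 2 <= 1.
Proof.
have h := partition_sum1 hpsi x.
have nd : nondecreasing_seq (series (fun j => psi j x ^+ 2)).
  by apply: nondecreasing_series => n _ _; exact: sqr_ge0.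
have cv : cvgn (series (fun j => psi j x ^+ 2)) by apply/cvg_ex; exists 1.
have := nondecreasing_cvgn_le nd cv j.+1; rewrite (cvg_lim (@Rhausdorff R) h).
apply: le_trans; rewrite /series /= big_nat_recr //= lerDr sumr_ge0 // => i _.
exact: sqr_ge0.
Qed.

(** On block j frequencies are comparable to 2^j. The first bound pays for the Zygmund weight, the
    second makes the block a finite sum; the added 1 covers block 0. *)
Lemma psi_support j x : psi j x != 0 ->
  2 ^+ j <= 4 * (`|x| + 1) /\ `|x| <= 2 ^+ j.
Proof.
case: j => [|j] /eqP px.
  have : ~ (1 < `|x|) by move=> /(partition_supp0 hpsi).
  by move/negP; rewrite -leNgt expr0; have := normr_ge0 x; lra.
have [y [xy /andP[y1 y2]]] : exists y, x = 2 ^+ j * y /\ 2^-1 <= `|y| <= 2.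
  case: j px => [|j] px.
    exists x; rewrite expr0 mul1r; split=> //; apply: contra_notT px.
    exact: (partition_supp1 hpsi).
  exists (2 `^ (1 - j.+2%:R) * x); split.
    have -> : 1 - j.+2%:R = - j.+1%:R :> R by rewrite -[in LHS](natr1 j.+1); ring.
    by rewrite powR_invn // mulVKf // expf_neq0 // pnatr_eq0.
  rewrite (partition_dyadic hpsi) // in px.
  by apply: contra_notT px; exact: (partition_supp1 hpsi).
rewrite xy normrM normrX normr_nat exprS.
have : 0 < 2 ^+ j :> R by rewrite exprn_gt0.
by split; nra.
Qed.

Let sym_psi_ge0 j n : 0 <= sym_even (psq j) n.
Proof.
by rewrite /sym_even; have := sqr_ge0 (psi j n%:R);
  have := sqr_ge0 (psi j (- n%:R)); lra.
Qed.

Let sym_psi_le1 j n : sym_even (psq j) n <= 1.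
Proof.
by rewrite /sym_even; have := psi_sq_le1 j n%:R;
  have := psi_sq_le1 j (- n%:R); lra.
Qed.

Let sym_psi_neq0 j n : sym_even (psq j) n != 0 ->
  2 ^+ j <= 4 * n.+1%:R :> R /\ (n <= 2 ^ j)%N.
Proof.
move=> h; have : (psi j n%:R != 0) || (psi j (- n%:R) != 0).
  rewrite -negb_and; apply: contra h => /andP[/eqP h1 /eqP h2].
  by rewrite /sym_even h1 h2 expr0n /= addr0 mul0r.
have -> : n.+1%:R = n%:R + 1 :> R by rewrite natr1.
rewrite -(ler_nat R) natrX.
by case/orP => /psi_support; rewrite ?normrN normr_nat.
Qed.

(** On block j the Zygmund weight is at most 2^(jp), hence at most (4 (n + 1))^p at each frequency n
    of the block: this is the origin of [4 ^+ p]. The 2 comes from [normc_multiplier_le]. *)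
Lemma zygmund_norm_le_wbound s p u (B : R) : even_periodic u -> s <= p%:R ->
  wbound p u B -> (zygmund_norm psi s u <= (2 * 4 ^+ p * B)%:E)%E.
Proof.
move=> epu sp uB; apply: ub_ereal_sup => _ [j _ [x _ <-]]; rewrite lee_fin.
have w0 : 0 < 2 `^ (j%:R * s) :> R by rewrite powR_gt0.
have B0 := wbound_ge0 uB.
have := @normc_multiplier_le _ (psq j) u x (4 ^+ p * B / 2 `^ (j%:R * s)) epu.
move=> /(_ (fun y => sqr_ge0 _)) H.
rewrite -ler_pdivlMl //; apply: le_trans (H _) _; last first.
  by rewrite le_eqVlt; apply/orP; left; apply/eqP; ring.
move=> N; rewrite ler_pdivlMr // mulr_suml.
apply: le_trans (ler_wpM2l _ (uB N)); last by rewrite exprn_ge0.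
rewrite mulr_sumr; apply: ler_sum => n _.
rewrite mulrAC [leRHS]mulrCA [leRHS]mulrC ler_wpM2r //.
have [->|/sym_psi_neq0[h _]] := eqVneq (sym_even (psq j) n) 0.
  by rewrite mul0r mulr_ge0 // exprn_ge0.
apply: (@le_trans _ _ (1 * 2 `^ (j%:R * p%:R))).
  by apply: ler_pM; rewrite ?powR_ge0 // ler_powR ?ler_wpM2l // ler1n.
by rewrite mul1r -natrM powR_mulrn // exprM -exprMn lerXn2r ?nnegrE ?exprn_ge0 //.
Qed.

(** Parseval bounds the sum of squares by 2 B^2, and |q| <= q^2 / (2 l) + l / 2 does the work of the
    Cauchy-Schwarz inequality; [l] is left free to be optimised. *)
Lemma bernstein_ineq (q : nat -> R) D (B l : R) : 0 < l -> 0 <= B ->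
  (forall x, `|\sum_(0 <= n < D) q n * cos (n%:R * x)| <= B) ->
  \sum_(0 <= n < D) `|q n| <= B ^+ 2 / l + l * D%:R / 2.
Proof.
move=> l0 B0 qB; pose r := [seq (q n, n) | n <- index_iota 0 D].
have evE x : ev r x = \sum_(0 <= n < D) q n * cos (n%:R * x).
  by rewrite /ev big_map.
have [cr _ _] := even_periodic_ev r.
have amp_r n : (n < D)%N -> amp (ev r) n = q n.
  move=> nD; rewrite amp_ev /coefc /r big_map big_mkcond /= (bigD1_seq n)
    ?iota_uniq ?mem_index_iota //= eqxx big1 ?addr0 // => i.
  by move/negbTE ->.
have parseval : \sum_(0 <= n < D) q n ^+ 2 <= 2 * B ^+ 2.
  have h : avg (fun x => ev r x * ev r x) <= B ^+ 2.
    rewrite -[leRHS](avg_cst (B ^+ 2)); apply: le_avg => [||x _].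
    - exact: continuous_funM.
    - exact: continuous_fun_cst.
    rewrite -expr2 -(real_normK (num_real (ev r x))) lerXn2r ?nnegrE //.
    by rewrite evE.
  have E : avg (fun x => ev r x * ev r x) =
      \sum_(0 <= n < D) q n * avg (fun x => ev r x * cos (n%:R * x)).
    under eq_fun do rewrite {2}evE mulr_sumr.
    rewrite avg_sum => [|i]; last first.
      apply: continuous_funM => //; apply: continuous_funM.
        exact: continuous_fun_cst.
      exact: continuous_cosM.
    apply: eq_bigr => n _; rewrite -avgZ; last first.
      by apply: continuous_funM => //; exact: continuous_cosM.
    by congr avg; apply/funext => x; rewrite mulrCA.
  apply: le_trans (ler_wpM2l _ h) => //; rewrite E mulr_sumr.
  rewrite !big_nat; apply: ler_sum => n /andP[_ nD].
  have q0 := sqr_ge0 (q n).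
  have := amp_r n nD; rewrite /amp; case: ifP => _; rewrite ?mul1r => {1 2}<-.
    by rewrite expr2; have := sqr_ge0 (avg (fun x => ev r x * cos (n%:R * x))); rewrite expr2; nra.
  by nra.
apply: (@le_trans _ _ (\sum_(0 <= n < D) (q n ^+ 2 / (2 * l) + l / 2))).
  apply: ler_sum => n _.
  have -> : q n ^+ 2 / (2 * l) + l / 2 = `|q n| + (`|q n| - l) ^+ 2 / (2 * l).
    by rewrite -(real_normK (num_real (q n))); field; rewrite gt_eqF.
  by rewrite lerDl divr_ge0 // ?sqr_ge0 // mulr_ge0 // ltW.
rewrite big_split /= -mulr_suml sumr_const_nat subn0 -[_ *+ D]mulr_natr.
apply: lerD; last by rewrite mulrAC.
rewrite ler_pdivrMr ?mulr_gt0 //; apply: le_trans parseval _.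
by rewrite le_eqVlt; apply/orP; left; apply/eqP; field; rewrite gt_eqF.
Qed.

(** The block has no frequency above 2^j, so the real part of the multiplier is the limit of an
    eventually constant sequence, and it is at most the modulus. *)
Lemma zygmund_block_le s b u j x : even_periodic u ->
  (zygmund_norm psi s u <= b%:E)%E ->
  `|\sum_(0 <= n < (2 ^ j).+1) sym_even (psq j) n * amp u n * cos (n%:R * x)|
    <= b / 2 `^ (j%:R * s).
Proof.
move=> epu ub.
have w0 : 0 < 2 `^ (j%:R * s) :> R by rewrite powR_gt0.
have hn : ComplexField.Normc.normc (multiplier (psq j) u x) <= b / 2 `^ (j%:R * s).
  rewrite ler_pdivlMr // mulrC -lee_fin; apply: le_trans ub.
  by apply: ereal_sup_ubound; exists j => //; exists x.
apply: le_trans hn; rewrite multiplier_even //=.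
set A := limn _; set C := limn _.
have <- : A = \sum_(0 <= n < (2 ^ j).+1) sym_even (psq j) n * amp u n * cos (n%:R * x).
  apply: (@lim_near_cst R); first exact: Rhausdorff.
  near=> N; have NJ : (2 ^ j <= N)%N by near: N; exact: nbhs_infty_ge.
  rewrite (big_cat_nat (n := (2 ^ j).+1)) //= [X in _ + X]big1_seq ?addr0 // => n.
  rewrite mem_index_iota => /andP[_ /andP[nj _]].
  have -> : sym_even (psq j) n = 0; last by rewrite !mul0r.
  by apply/eqP; apply: contraTT nj => /sym_psi_neq0[_]; rewrite -ltnNge ltnS.
rewrite -sqrtr_sqr; apply: ler_wsqrtr; rewrite lerDl; exact: sqr_ge0.
Unshelve. all: by end_near. Qed.

Lemma sum_sym_psi n : series (fun j => sym_even (psq j) n) @ \oo --> (1 : R).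
Proof.
have h1 := partition_sum1 hpsi n%:R; have h2 := partition_sum1 hpsi (- n%:R).
have -> : series (fun j => sym_even (psq j) n) = (fun N =>
    (\sum_(0 <= j < N) psi j n%:R ^+ 2 + \sum_(0 <= j < N) psi j (- n%:R) ^+ 2) / 2).
  by apply/funext => N; rewrite /series /= -big_split /= mulr_suml.
have := cvgM (cvgD h1 h2) (cvg_cst (2^-1 : R)).
by rewrite (_ : (1 + 1) * 2^-1 = 1 :> R); [exact|field].
Qed.

(* Bernstein: each dyadic block carries at most of order 2^j frequencies, hence
   costs 2^(j/2) when passing from the sup norm to the absolute sum of the
   amplitudes; this is summable against 2^(-js) because s > 1/2. *)
Lemma wbound_zygmund_norm s : 1 / 2 < s ->
  exists2 C : R, 0 < C & forall u b, even_periodic u -> 0 < b ->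
    (zygmund_norm psi s u <= b%:E)%E -> wbound 0 u (C * b).
Proof.
move=> hs; pose r : R := 2 `^ 2^-1; pose w : R := 2 `^ s; pose th := r / w.
have r0 : 0 < r by rewrite powR_gt0.
have w0 : 0 < w by rewrite powR_gt0.
have rr : r ^+ 2 = 2 by rewrite /r powR12_sqrt // sqr_sqrtr.
have th0 : 0 <= th by rewrite divr_ge0 // ltW.
have th1 : th < 1.
  rewrite ltr_pdivrMr // mul1r /r /w lt_neqAle; apply/andP; split; last first.
    by rewrite ler_powR ?ler1n //; lra.
  apply/eqP => E.
  have l2 : 0 < ln (2 : R) by rewrite ln_gt0 // ltr1n.
  have : ln (2 `^ 2^-1) = ln (2 `^ s) :> R by rewrite E.
  rewrite !ln_powR => /(mulIf (lt0r_neq0 l2)) H; lra.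
have th1' : 0 < 1 - th by rewrite subr_gt0.
exists (2 / (1 - th) * 2); first by rewrite mulr_gt0 // divr_gt0.
move=> u b epu b0 ub N.
pose q j n := sym_even (psq j) n * amp u n.
have block j M : \sum_(0 <= n < M) `|q j n| <= 2 * 2 * b * th ^+ j.
  apply: (@le_trans _ _ (\sum_(0 <= n < (2 ^ j).+1) `|q j n|)).
    apply: (@le_trans _ _ (\sum_(0 <= n < maxn M (2 ^ j).+1) `|q j n|)).
      rewrite [leRHS](big_cat_nat (n := M)) //= ?leq_maxl // lerDl sumr_ge0 //.
    rewrite (big_cat_nat (n := (2 ^ j).+1)) //= ?leq_maxr //.
    rewrite [X in _ + X]big1_seq ?addr0 // => n.
    rewrite mem_index_iota => /andP[_ /andP[nj _]].
    have -> : q j n = 0; last by rewrite normr0.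
    rewrite /q; have -> : sym_even (psq j) n = 0; last by rewrite mul0r.
    by apply/eqP; apply: contraTT nj => /sym_psi_neq0[_]; rewrite -ltnNge ltnS.
  have wj : 2 `^ (j%:R * s) = w ^+ j by rewrite mulrC powRrM powR_mulrn // ltW.
  have wj0 : 0 < w ^+ j by rewrite exprn_gt0.
  have rj0 : 0 < r ^+ j by rewrite exprn_gt0.
  pose B := b / w ^+ j.
  have B0 : 0 < B by rewrite divr_gt0.
  have rj2 : r ^+ j ^+ 2 = 2 ^+ j by rewrite -exprM mulnC exprM rr.
  (* This value of [l] balances the two terms of [bernstein_ineq]: each is at most [B * r ^+ j]. *)
  have l0 : 0 < B / r ^+ j by rewrite divr_gt0.
  have := bernstein_ineq l0 (ltW B0) (D := (2 ^ j).+1) (q := q j).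
  rewrite /B -wj => /(_ (fun x => zygmund_block_le j x epu ub)) H.
  apply: le_trans H _; rewrite wj -/B.
  have -> : 2 * 2 * b * th ^+ j = 4 * B * r ^+ j.
    by rewrite /th /B expr_div_n; field; rewrite gt_eqF.
  have D2 : (2 ^ j).+1%:R <= 2 * 2 ^+ j :> R.
    by rewrite -natrX -natrM ler_nat mul2n -addnn -addn1 leq_add2l expn_gt0.
  have -> : B ^+ 2 / (B / r ^+ j) = B * r ^+ j.
    by field; rewrite !gt_eqF.
  have : B / r ^+ j * (2 ^ j).+1%:R / 2 <= B * r ^+ j.
    rewrite ler_pdivrMr //; apply: le_trans (ler_wpM2l (ltW l0) D2) _.
    rewrite -rj2 le_eqVlt; apply/orP; left; apply/eqP; field.
    by rewrite gt_eqF.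
  have : 0 < B * r ^+ j by rewrite mulr_gt0.
  lra.
(* Each amplitude is resolved by the partition of unity; exchanging the sums leaves one over blocks,
   dominated by a geometric series of ratio [th]. *)
apply: (@lim_le_bound _ (fun J => \sum_(0 <= n < N)
    (series (fun j => sym_even (psq j) n) J * `|amp u n|))).
  apply: (cvg_big (op := +%R)) => [|n _]; first by exact: add_continuous.
  rewrite expr0 mulr1 -[X in _ --> X]mul1r.
  exact: (cvgM (sum_sym_psi n) (cvg_cst `|amp u n|)).
move=> J; under eq_bigr do rewrite /series /= mulr_suml.
rewrite exchange_big /=.
apply: (@le_trans _ _ (\sum_(0 <= j < J) 2 * 2 * b * th ^+ j)).
  apply: ler_sum => j _; apply: le_trans (block j N).
  by apply: ler_sum => n _; rewrite [leRHS]normrM (ger0_norm (sym_psi_ge0 j n)).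
rewrite -mulr_sumr.
have -> : 2 / (1 - th) * 2 * b = 2 * 2 * b * (1 - th)^-1 by ring.
apply: ler_wpM2l; first by rewrite !mulr_ge0 // ltW.
rewrite -[leRHS]mul1r ler_pdivlMr //.
have : \sum_(0 <= j < J) th ^+ j * (1 - th) = 1 - th ^+ J.
  elim: J => [|J IH]; first by rewrite big_geq // expr0 subrr.
  by rewrite big_nat_recr //= IH exprSr; ring.
rewrite -mulr_suml => ->; have : 0 <= th ^+ J by rewrite exprn_ge0.
lra.
Qed.

End Zygmund.

(** * The Whitham symbol *)

Section Symbol.
Context {R : realType} (kappa T : R).
Hypotheses (hkappa : 0 < kappa) (hT : 0 < T).
Implicit Types (n k : nat).

Local Notation l n := (scaled_symbol kappa T n%:R).

Lemma tanh_gt0 (x : R) : 0 < x -> 0 < tanh x.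
Proof.
move=> x0; rewrite /tanh divr_gt0 //.
  by rewrite subr_gt0 ltr_expR; lra.
by rewrite addr_gt0 // expR_gt0.
Qed.

Lemma tanh_ge_half (x : R) : 1 <= x -> 2^-1 <= tanh x.
Proof.
move=> x1; rewrite /tanh expRN; set a := expR x.
have a2 : 2 <= a by apply: le_trans (expR_ge1Dx x); lra.
have a0 : 0 < a by lra.
have ai : a^-1 <= 2^-1 by rewrite lef_pV2 ?posrE //; lra.
have ai0 : 0 < a^-1 by rewrite invr_gt0.
by rewrite ler_pdivlMr; lra.
Qed.

Lemma scaled_symbol_gt0 n : 0 < l n.
Proof.
rewrite /scaled_symbol /whitham_symbol; case: eqP => // /eqP kn0.
have n0 : 0 < kappa * n%:R by rewrite lt_neqAle eq_sym kn0 mulr_ge0 // ltW.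
rewrite sqrtr_gt0 divr_gt0 // mulr_gt0 ?tanh_gt0 // ltr_wpDr //.
by rewrite mulr_ge0 ?sqr_ge0 // ltW.
Qed.

Lemma scaled_symbol_small (e : R) : 0 < e ->
  exists N, forall n, (N <= n)%N -> l n < e.
Proof.
(* The first entry gives kappa n >= 1, where tanh is at least 1/2 and the squared symbol is below 2
   / (T kappa n); the second makes that quantity smaller than e^2. *)
move=> e0; pose b := Num.max (kappa^-1) (2 / (T * kappa * e ^+ 2)).
have b1 : kappa^-1 <= b by rewrite le_max lexx.
have b2 : 2 / (T * kappa * e ^+ 2) <= b by rewrite le_max lexx orbT.
have ki : 0 < kappa^-1 by rewrite invr_gt0.
have b0 : 0 <= b by lra.
exists (Num.bound b) => n bn.
have {bn}bn : b < n%:R.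
  by apply: lt_le_trans (archi_boundP b0) _; rewrite ler_nat.
have x1 : 1 <= kappa * n%:R.
  by rewrite mulrC -ler_pdivrMr // mul1r; lra.
have x2 : 2 < T * (kappa * n%:R) * e ^+ 2.
  have : 2 / (T * kappa * e ^+ 2) < n%:R by lra.
  by rewrite ltr_pdivrMr ?mulr_gt0 ?exprn_gt0 //; lra.
rewrite /scaled_symbol /whitham_symbol; move: x1 x2; set x := kappa * n%:R => x1 x2.
have x0 : 0 < x by lra.
have th := tanh_ge_half x1.
rewrite gt_eqF // -(ger0_norm (ltW e0)) -sqrtr_sqr ltr_sqrt ?exprn_gt0 //.
have Tx : 0 < T * x ^+ 2 by rewrite mulr_gt0 // exprn_gt0.
have d0 : 0 < (1 + T * x ^+ 2) * tanh x by rewrite mulr_gt0 //; lra.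
rewrite ltr_pdivrMr //.
apply: (@lt_le_trans _ _ (e ^+ 2 * (T * x ^+ 2 * 2^-1))).
  rewrite [ltRHS](_ : _ = (T * x * e ^+ 2) * x / 2); last by ring.
  by rewrite ltr_pdivlMr // mulrC ltr_pM2r.
by rewrite ler_wpM2l ?sqr_ge0 // ler_pM //; lra.
Qed.

Lemma series_eventually_cst (g : nat -> R) m : (forall n, n != m -> g n = 0) ->
  series g @ \oo --> g m.
Proof.
move=> g0; apply: cvg_near_cst; near=> N.
have mN : (m < N)%N by near: N; exact: nbhs_infty_gt.
rewrite /series /= (bigD1_seq m) ?iota_uniq ?mem_index_iota //= big1 ?addr0 //.
Unshelve. all: by end_near. Qed.

Lemma whitham_op_cos n (x : R) :
  whitham_op kappa T (fun y => cos (n%:R * y)) x = l n * cos (n%:R * x).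
Proof.
apply: whitham_op_cvg; first exact: even_periodic_cos.
have := @series_eventually_cst (fun m => l m * amp (fun y => cos (n%:R * y)) m *
  cos (m%:R * x)) n.
rewrite amp_cos eqxx mulr1; apply=> m mn.
by rewrite amp_cos eq_sym (negbTE mn) mulr0 mul0r.
Qed.

Definition reduced_inverse k n : R :=
  if n == k then 0 else l n / (1 - (l k)^-1 * l n).

(** Once [l n < l k / 2], the denominator is at least 1/2 and the quotient at most [l k]; the
    finitely many earlier modes are covered by their sum. *)
Lemma reduced_inverse_bounded k :
  exists2 K : R, 0 < K & forall n, `|reduced_inverse k n| <= K.
Proof.
pose M := reduced_inverse k; have lk0 := scaled_symbol_gt0 k.
have lk2 : 0 < l k / 2 by rewrite divr_gt0.
have [N HN] := scaled_symbol_small lk2.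
have S0 : 0 <= \sum_(0 <= n < N) `|M n| by rewrite sumr_ge0.
exists (l k + \sum_(0 <= n < N) `|M n|); first by lra.
move=> n; rewrite -/(M n); have [nN|Nn] := ltnP n N.
  rewrite (bigD1_seq n) ?iota_uniq ?mem_index_iota //= addrCA lerDl addr_ge0 ?(ltW lk0) //.
  by rewrite sumr_ge0.
suff : `|M n| <= l k by lra.
rewrite /M /reduced_inverse; case: ifP => _; first by rewrite normr0 ltW.
have ln0 := scaled_symbol_gt0 n; have lnk := HN n Nn.
have d2 : 2^-1 <= 1 - (l k)^-1 * l n.
  have : (l k)^-1 * l n <= 2^-1 by rewrite ler_pdivrMl //; lra.
  lra.
rewrite normrM (gtr0_norm ln0) normfV gtr0_norm; last by lra.
rewrite ler_pdivrMr; last by lra.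
have : l k * 2^-1 <= l k * (1 - (l k)^-1 * l n) by rewrite ler_pM2l.
lra.
Qed.

Section Kernel.
Context (psi : nat -> R -> R) (hpsi : zygmund_partition psi) (s : R).

Lemma zygmund_even_wbound p u (B : R) : even_periodic u -> s <= p%:R ->
  wbound p u B -> zygmund_even psi s u.
Proof.
move=> epu sp uB; have [cu pu eu] := epu; split => //; split => //.
by apply: le_lt_trans (zygmund_norm_le_wbound hpsi epu sp uB) _; rewrite ltry.
Qed.

Lemma wbound_cos p n : wbound p (fun x : R => cos (n%:R * x)) (n.+1%:R ^+ p).
Proof.
have -> : (fun x : R => cos (n%:R * x)) = ev [:: (1, n)].
  by apply/funext => x; rewrite /ev big_seq1 mul1r.
suff -> : n.+1%:R ^+ p = tnorm p [:: ((1 : R), n)] by exact: wbound_ev.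
by rewrite /tnorm big_seq1 normr1 mul1r.
Qed.

Lemma zygmund_even_cos n : zygmund_even psi s (fun x => cos (n%:R * x)).
Proof.
apply: (@zygmund_even_wbound (Num.bound s)) (even_periodic_cos n) _ (@wbound_cos _ n).
have [s0|/ltW s0] := leP 0 s; first exact: ltW (archi_boundP s0).
by apply: le_trans s0 _.
Qed.

(** If [l n = l k], the cosines of frequencies n and k both lie in the kernel, hence are multiples
    of one function. Both equal 1 at 0, so they coincide, and their amplitudes force n = k. *)
Lemma simple_kernel k : has_dim (linearization_kernel psi s kappa T (l k)^-1) 1 ->
  forall n, n != k -> l n != l k.
Proof.
case=> e [_ ker] n; apply: contra => /eqP nk.
have lk0 := scaled_symbol_gt0 k.
have inker m : l m = l k ->
    linearization_kernel psi s kappa T (l k)^-1 (fun x => cos (m%:R * x)).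
  move=> mk; split; first exact: zygmund_even_cos.
  apply/funext => x; rewrite /whitham_linearization whitham_op_cos mk.
  by rewrite mulKf ?gt_eqF // subrr.
have := inker k erefl; have := inker n nk; rewrite ker => -[a _ ae] [b _ be].
rewrite big_ord1 in ae; rewrite big_ord1 in be.
have a1 : a ord0 * e ord0 0 = 1.
  by have := congr1 (fun f => f 0) ae; rewrite /= mulr0 cos0.
have b1 : b ord0 * e ord0 0 = 1.
  by have := congr1 (fun f => f 0) be; rewrite /= mulr0 cos0.
have ab : a ord0 = b ord0.
  apply/eqP; rewrite -subr_eq0; have : (a ord0 - b ord0) * e ord0 0 = 0.
    by rewrite mulrBl a1 b1 subrr.
  move/eqP; rewrite mulf_eq0 => /orP[//|/eqP e0].
  by move: a1; rewrite e0 mulr0 => /eqP; rewrite eq_sym oner_eq0.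
have nkcos : (fun x : R => cos (n%:R * x)) = (fun x => cos (k%:R * x)).
  by rewrite -ae -be ab.
have := amp_cos n k (R := R); rewrite nkcos amp_cos eqxx; case: eqP => // _ /eqP.
by rewrite oner_eq0.
Qed.

End Kernel.
End Symbol.

(** * Power series with function coefficients *)

Section CauchyProduct.
Context {R : realType}.
Implicit Types (u v : nat -> R) (N m : nat).

Definition cauchy u v m : R := \sum_(0 <= i < m.+1) u i * v (m - i)%N.

Lemma series_cauchy u v N :
  series (cauchy u v) N = \sum_(0 <= i < N) u i * series v (N - i)%N.
Proof.
elim: N => [|N IH]; first by rewrite /series /= !big_geq.
rewrite seriesSr [series _ N](_ : _ = \sum_(0 <= i < N.+1) u i * series v (N - i)%N).
  rewrite /cauchy -big_split /=; apply: eq_big_nat => i /andP[_ iN].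
  by rewrite -mulrDr subSn // seriesSr.
have s0 : series v 0%N = 0 by rewrite /series /= big_geq.
by rewrite IH big_nat_recr //= subnn s0 mulr0 addr0.
Qed.

Lemma cauchy_ge0 u v m : (forall n, 0 <= u n) -> (forall n, 0 <= v n) ->
  0 <= cauchy u v m.
Proof. by move=> u0 v0; apply: sumr_ge0 => i _; rewrite mulr_ge0. Qed.

Lemma cauchyX (r : R) u v m :
  r ^+ m * cauchy u v m = cauchy (fun n => r ^+ n * u n) (fun n => r ^+ n * v n) m.
Proof.
rewrite /cauchy mulr_sumr; apply: eq_big_nat => i /andP[_]; rewrite ltnS => im.
have -> : r ^+ m = r ^+ i * r ^+ (m - i) by rewrite -exprD subnKC.
by ring.
Qed.

Lemma series_nondecreasing v m N : (forall n, 0 <= v n) -> (m <= N)%N ->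
  series v m <= series v N.
Proof. by move=> v0; apply: nondecreasing_series => i _ _. Qed.

Lemma series_cauchy_le u v N : (forall n, 0 <= u n) -> (forall n, 0 <= v n) ->
  series (cauchy u v) N <= series u N * series v N.
Proof.
move=> u0 v0; rewrite series_cauchy [X in _ <= X * _]/series /= mulr_suml.
apply: ler_sum => i _; apply: ler_wpM2l => //.
by apply: series_nondecreasing => //; exact: leq_subr.
Qed.

(* The defect U_N V_N - C_N is dominated by the same defect for the absolute
   values, which tends to 0 by monotonicity. *)
Lemma cauchy_product_cvg u v (A B : R) :
  (forall N, series (fun n => `|u n|) N <= A) ->
  (forall N, series (fun n => `|v n|) N <= B) ->
  series (cauchy u v) @ \oo --> limn (series u) * limn (series v).
Proof.
move=> uA vB; pose u' n := `|u n|; pose v' n := `|v n|.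
have u0 n : 0 <= u' n by exact: normr_ge0.
have v0 n : 0 <= v' n by exact: normr_ge0.
have [cu _ _] := dominated_series_cvg (fun n => lexx (u' n)) uA.
have [cv _ _] := dominated_series_cvg (fun n => lexx (v' n)) vB.
have [cu' _ uU] := bounded_series_cvg u0 uA.
have [cv' _ vV] := bounded_series_cvg v0 vB.
have c0 m : 0 <= cauchy u' v' m by exact: cauchy_ge0.
have s0 (w : nat -> R) N : (forall n, 0 <= w n) -> 0 <= series w N.
  by move=> w0; apply: sumr_ge0 => i _.
have cAB N : series (cauchy u' v') N <= A * B.
  apply: le_trans (series_cauchy_le _ u0 v0) _.
  by apply: ler_pM; rewrite ?s0 ?uA ?vB.
have [cc _ cL] := bounded_series_cvg c0 cAB.
pose L := limn (series u') * limn (series v').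
have UV : series u' N * series v' N @[N --> \oo] --> L.
  exact: (cvgM cu' cv').
have lim_c : limn (series (cauchy u' v')) = L.
  apply/eqP; rewrite eq_le; apply/andP; split.
    apply: lim_le_bound cc _ => N; apply: le_trans (series_cauchy_le _ u0 v0) _.
    by apply: ler_pM; rewrite ?s0.
  apply: lim_le_bound UV _ => N.
  (* The Cauchy sum of length 2N contains all products whose two indices are below N. *)
  apply: le_trans (cL N.*2).
  rewrite series_cauchy (big_cat_nat (n := N)) //= -?addnn ?leq_addr //.
  apply: (@le_trans _ _ (\sum_(0 <= i < N) u' i * series v' (N + N - i)%N)).
    rewrite [X in X * _ <= _]/series /= mulr_suml [leLHS]big_nat [leRHS]big_nat.
    apply: ler_sum => i /andP[_ iN]; apply: ler_wpM2l => //.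
    by apply: series_nondecreasing => //; rewrite -addnBA ?leq_addr // ltnW.
  by rewrite lerDl sumr_ge0 // => i _; rewrite mulr_ge0 ?s0.
have E : (series u' N * series v' N - series (cauchy u' v') N) @[N --> \oo] --> (0 : R).
  by rewrite -(subrr L) -{2}lim_c; exact: cvgB UV cc.
have D : (series u N * series v N - series (cauchy u v) N) @[N --> \oo] --> (0 : R).
  apply: cvg_dist0 E _ => N; rewrite subr0 !series_cauchy.
  rewrite [series u N]/series [series u' N]/series /= !mulr_suml -!sumrB.
  apply: le_trans (ler_norm_sum _ _ _) _; rewrite [leLHS]big_nat [leRHS]big_nat.
  apply: ler_sum => i /andP[_ iN]; rewrite -!mulrBr normrM ler_wpM2l //.
  rewrite !series_subB ?leq_subr //; exact: ler_norm_sum.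
have -> : series (cauchy u v) = (fun N => series u N * series v N -
    (series u N * series v N - series (cauchy u v) N)).
  by apply/funext => N; rewrite subKr.
rewrite -[X in _ --> X]subr0; exact: (cvgB (cvgM cu cv) D).
Qed.

End CauchyProduct.

(** * Differentiation of function-valued power series *)

Section PowerSeries.
Context {R : realType} (p : nat).
Implicit Types (f : nat -> R -> R) (t h r : R).

Definition vps f t (x : R) : R := limn (series (fun m => t ^+ m * f m x)).

Definition dcoef f m (x : R) : R := m.+1%:R * f m.+1 x.

Lemma sum_succ_geometric_le (th : R) N : 0 <= th < 1 ->
  \sum_(0 <= m < N) m.+1%:R * th ^+ m <= (1 - th) ^- 2.
Proof.
move=> /andP[th0 th1]; have d0 : 0 < (1 - th) ^+ 2 by rewrite exprn_gt0 // subr_gt0.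
rewrite -[leRHS]mul1r ler_pdivlMr //.
suff -> : (\sum_(0 <= m < N) m.+1%:R * th ^+ m) * (1 - th) ^+ 2 =
    1 - th ^+ N * (1 + N%:R * (1 - th)).
  have : 0 <= th ^+ N * (1 + N%:R * (1 - th)).
    by rewrite mulr_ge0 ?exprn_ge0 // addr_ge0 // mulr_ge0 // subr_ge0 ltW.
  by lra.
elim: N => [|N IH]; first by rewrite big_geq // expr0; ring.
have n1 : N.+1%:R = N%:R + 1 :> R by rewrite natr1.
by rewrite big_nat_recr //= mulrDl IH [th ^+ N.+1]exprS n1; ring.
Qed.

(** For a nonnegative majorant, a radius of convergence of at least [rho]. Only radii strictly below
    [rho] are tested, so that the property survives differentiation. *)
Definition radius_ge (rho : R) (F : nat -> R) : Prop :=
  forall r, 0 <= r < rho -> exists C, forall N, series (fun m => r ^+ m * F m) N <= C.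

(** Boundedness at an intermediate radius [r'] makes F m at most C / r'^m, and the factor m + 1 is
    absorbed by the geometric ratio r / r'. *)
Lemma radius_ge_deriv rho F : (forall m, 0 <= F m) -> radius_ge rho F ->
  radius_ge rho (fun m => m.+1%:R * F m.+1).
Proof.
move=> F0 Frho r /andP[r0 rrho]; pose r' := (r + rho) / 2.
have r'0 : 0 < r' by rewrite /r'; lra.
have [|C FC] := Frho r'; first by rewrite /r'; lra.
have FrC m : r' ^+ m * F m <= C.
  apply: le_trans (FC m.+1); rewrite seriesSr lerDr sumr_ge0 // => i _.
  by rewrite mulr_ge0 // exprn_ge0 // ltW.
have th : 0 <= r / r' < 1.
  by rewrite divr_ge0 ?(ltW r'0) //= ltr_pdivrMr // mul1r /r'; lra.
exists (C / r' * (1 - r / r') ^- 2) => N.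
have C0 : 0 <= C by apply: le_trans (FrC 0%N); rewrite mulr_ge0 // exprn_ge0 // ltW.
apply: le_trans (ler_wpM2l _ (sum_succ_geometric_le N th)); last first.
  by rewrite divr_ge0 // ltW.
rewrite mulr_sumr; apply: ler_sum => m _.
have -> : C / r' * (m.+1%:R * (r / r') ^+ m) = m.+1%:R * (r ^+ m * (C / r' ^+ m.+1)).
  by rewrite expr_div_n exprS; field; rewrite expf_neq0 gt_eqF.
rewrite mulrCA ler_wpM2l // ler_wpM2l ?exprn_ge0 //.
by rewrite ler_pdivlMr ?exprn_gt0 // mulrC.
Qed.

Definition analytic_coefs (rho : R) f : Prop :=
  (forall m, even_periodic (f m)) /\
  exists2 F : nat -> R, forall m, wbound p (f m) (F m) & radius_ge rho F.

Lemma analytic_dcoef rho f : analytic_coefs rho f -> analytic_coefs rho (dcoef f).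
Proof.
move=> [ef [F fF Frho]]; split; first by move=> m; exact: even_periodicZ.
exists (fun m => m.+1%:R * F m.+1); last first.
  by apply: radius_ge_deriv => // m; exact: wbound_ge0 (fF m).
move=> m; have -> : m.+1%:R * F m.+1 = `|m.+1%:R| * F m.+1 by rewrite normr_nat.
by apply: wboundZ => //; case: (ef m.+1).
Qed.

Lemma analytic_iter_dcoef rho f n : analytic_coefs rho f ->
  analytic_coefs rho (iter n dcoef f).
Proof. by move=> af; elim: n => //= n IH; exact: analytic_dcoef. Qed.

Lemma analytic_superposition rho f t : analytic_coefs rho f -> `|t| < rho ->
  exists B, [/\ even_periodic (vps f t), wbound p (vps f t) B,
    forall x, series (fun m => t ^+ m * f m x) @ \oo --> vps f t x &
    forall n, series (fun m => t ^+ m * amp (f m) n) @ \oo --> amp (vps f t) n].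
Proof.
move=> [ef [F fF Frho]] trho.
have [|B FB] := Frho `|t|; first by rewrite normr_ge0.
have cf m : continuous (f m) by case: (ef m).
have eg m : even_periodic (fun x => t ^+ m * f m x) by exact: even_periodicZ.
have gF m : wbound p (fun x => t ^+ m * f m x) (`|t| ^+ m * F m).
  by rewrite -normrX; exact: wboundZ.
have [U E W A] := superposition eg gF FB; exists B; split=> //.
  by move=> x; exact: (uniformly_to_cvg U).
by move=> n; have := A n; under eq_fun do rewrite ampZ //.
Qed.

(** The induction multiplies the remainder by [t + h]. The factor of h^2 is the coefficient of a
    second derivative at radius [r], so that it sums; exponents start at 2 because the remainder
    vanishes for 0 and 1. *)
Lemma taylor_monomial_le (t h r : R) m : `|t| + `|h| <= r ->
  `|(t + h) ^+ m.+2 - t ^+ m.+2 - m.+2%:R * t ^+ m.+1 * h| <=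
    h ^+ 2 * (m.+2%:R * m.+1%:R * r ^+ m).
Proof.
move=> thr; have r0 : 0 <= r by apply: le_trans thr; rewrite addr_ge0.
have thr' : `|t + h| <= r by apply: le_trans (ler_normD _ _) thr.
have tr : `|t| <= r by apply: le_trans thr; rewrite lerDl.
have nS j : j.+1%:R = j%:R + 1 :> R by rewrite natr1.
elim: m => [|m IH].
  rewrite (_ : _ - _ - _ = h ^+ 2); last by ring.
  by rewrite expr0 ger0_norm ?sqr_ge0 // mulr1 ler_peMr ?sqr_ge0 // mulr1 ler1n.
have -> : (t + h) ^+ m.+3 - t ^+ m.+3 - m.+3%:R * t ^+ m.+2 * h =
    (t + h) * ((t + h) ^+ m.+2 - t ^+ m.+2 - m.+2%:R * t ^+ m.+1 * h) +
    h ^+ 2 * (m.+2%:R * t ^+ m.+1).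
  by rewrite (nS m.+2) [(t + h) ^+ m.+3]exprS [t ^+ m.+3]exprS [t ^+ m.+2]exprS; ring.
have h1 : `|(t + h) * ((t + h) ^+ m.+2 - t ^+ m.+2 - m.+2%:R * t ^+ m.+1 * h)| <=
    r * (h ^+ 2 * (m.+2%:R * m.+1%:R * r ^+ m)) by rewrite normrM; apply: ler_pM.
have h2 : `|h ^+ 2 * (m.+2%:R * t ^+ m.+1)| <= h ^+ 2 * (m.+2%:R * r ^+ m.+1).
  rewrite normrM (ger0_norm (sqr_ge0 h)) ler_wpM2l ?sqr_ge0 //.
  rewrite normrM normr_nat ler_wpM2l // normrX lerXn2r ?nnegrE //.
apply: le_trans (ler_normD _ _) _.
apply: le_trans (lerD h1 h2) _; rewrite -subr_ge0 !nS [r ^+ m.+1]exprS.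
rewrite (_ : _ - _ = h ^+ 2 * (r * r ^+ m) * (m%:R + 1 + 1)); last by ring.
apply: mulr_ge0; last by rewrite !addr_ge0.
by apply: mulr_ge0; [exact: sqr_ge0|rewrite mulr_ge0 // exprn_ge0].
Qed.

(** The error of the difference quotient is again a series in the [f m], with coefficients [e m] of
    order |h|. Its majorant is |h| times that of the second derivative at radius [r], halfway
    between |t| and [rho]. *)
Lemma vps_difference_quotient rho f t : analytic_coefs rho f -> `|t| < rho ->
  exists C d, [/\ 0 <= C, 0 < d & forall h, 0 < `|h| < d ->
    `|t + h| < rho /\
    even_periodic (fun x => h^-1 * (vps f (t + h) x - vps f t x) - vps (dcoef f) t x) /\
    wbound p (fun x => h^-1 * (vps f (t + h) x - vps f t x) - vps (dcoef f) t x)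
      (C * `|h|)].
Proof.
move=> af trho; have adf := analytic_dcoef af.
pose d := (rho - `|t|) / 2; pose r := `|t| + d.
have d0 : 0 < d by rewrite /d; lra.
have r0 : 0 <= r by rewrite /r; have := normr_ge0 t; lra.
have [ef [F fF Frho]] := af.
have F0 m : 0 <= F m := wbound_ge0 (fF m).
have [C FC] : exists C, forall N,
    series (fun m => r ^+ m * (m.+1%:R * (m.+2%:R * F m.+2))) N <= C.
  apply: (radius_ge_deriv _ (radius_ge_deriv F0 Frho)) => [m|].
    by rewrite mulr_ge0.
  by rewrite r0 /r /d; lra.
have C0 : 0 <= C by apply: le_trans (FC 0%N); rewrite /series /= big_geq.
exists C, d; split=> // h /andP[h0 hd].
have hn0 : h != 0 by rewrite -normr_gt0.
have threp : `|t + h| < rho by have := ler_normD t h; rewrite /d in hd; lra.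
have thr : `|t| + `|h| <= r by rewrite /r; lra.
have [B1 [e1 w1 l1 _]] := analytic_superposition af trho.
have [B2 [e2 w2 l2 _]] := analytic_superposition af threp.
have [B3 [e3 w3 l3 _]] := analytic_superposition adf trho.
pose e m : R := h^-1 * ((t + h) ^+ m - t ^+ m) - m%:R * t ^+ m.-1.
have eE m : e m.+2 =
    h^-1 * ((t + h) ^+ m.+2 - t ^+ m.+2 - m.+2%:R * t ^+ m.+1 * h).
  by rewrite /e /=; field.
have e_0 : e 0%N = 0 by rewrite /e !expr0 subrr mulr0 mul0r subrr.
have e_1 : e 1%N = 0 by rewrite /e /= !expr1 expr0; field.
have eB m : `|e m.+2| <= `|h| * (m.+2%:R * m.+1%:R * r ^+ m).
  rewrite eE normrM normfV ler_pdivrMl //.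
  apply: le_trans (taylor_monomial_le m thr) _.
  by rewrite [leRHS]mulrA -[`|h| * `|h|]expr2 real_normK ?num_real.
pose G m := if m is m'.+2 then `|h| * (r ^+ m' * (m'.+1%:R * (m'.+2%:R * F m'.+2))) else 0.
have GC N : series G N <= C * `|h|.
  have G0 m : 0 <= G m.
    by case: m => [|[|m]] //=; rewrite !mulr_ge0 ?exprn_ge0.
  apply: (@le_trans _ _ (series G N.+2)).
    by apply: series_nondecreasing => //; rewrite -addn2 leq_addr.
  rewrite /series /= big_nat_recl // big_nat_recl //= !add0r -mulr_sumr mulrC.
  by rewrite ler_wpM2r // FC.
have egG m : wbound p (fun x => e m * f m x) (G m).
  have cfm : continuous (f m) by case: (ef m).
  have wm := wboundZ (e m) cfm (fF m).
  case: m cfm wm => [|[|m]] cfm wm /=.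
  - by rewrite e_0 normr0 mul0r in wm *.
  - by rewrite e_1 normr0 mul0r in wm *.
  apply: wbound_le wm; apply: le_trans (ler_wpM2r (F0 _) (eB m)) _.
  by rewrite le_eqVlt; apply/orP; left; apply/eqP; ring.
have ege m : even_periodic (fun x => e m * f m x) by exact: even_periodicZ.
have [_ E W _] := superposition ege egG GC.
suff -> : (fun x => h^-1 * (vps f (t + h) x - vps f t x) - vps (dcoef f) t x) =
    (fun x => limn (series (fun m => e m * f m x))) by [].
apply/funext => x; apply/esym/cvg_lim; first exact: Rhausdorff.
have l3' : series (fun m => m%:R * t ^+ m.-1 * f m x) @ \oo --> vps (dcoef f) t x.
  rewrite -(cvg_shiftS (series _)); move: (l3 x).
  rewrite (_ : (fun n => series (fun m => m%:R * t ^+ m.-1 * f m x) n.+1) =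
    series (fun m => t ^+ m * dcoef f m x)) //.
  apply/funext => N; rewrite /series /= big_nat_recl //= !mul0r add0r.
  by apply: eq_bigr => i _; rewrite /dcoef; ring.
have -> : series (fun m => e m * f m x) = (fun N => h^-1 *
  (series (fun m => (t + h) ^+ m * f m x) N - series (fun m => t ^+ m * f m x) N) -
  series (fun m => m%:R * t ^+ m.-1 * f m x) N).
  apply/funext => N; rewrite /series /= -sumrB mulr_sumr -sumrB.
  by apply: eq_bigr => i _; rewrite /e; ring.
exact: (cvgB (cvgM (cvg_cst h^-1) (cvgB (l2 x) (l1 x))) l3').
Qed.

(** A Wiener bound is a sup bound, so the estimate of the difference quotient descends to each
    point; this serves the wave speed. *)
Lemma vps_is_derive rho f t x : analytic_coefs rho f -> `|t| < rho ->
  is_derive t (1 : R) (fun t => vps f t x) (vps (dcoef f) t x).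
Proof.
move=> af trho; have [C [d [C0 d0 H]]] := vps_difference_quotient af trho.
have L : h^-1 *: (vps f (h *: (1 : R) + t) x - vps f t x) @[h --> 0^'] -->
    vps (dcoef f) t x.
  apply/cvgrPdist_le => e e0.
  near=> h.
  have h0 : 0 < `|h| by rewrite normr_gt0; near: h; exact: nbhs_dnbhs_neq.
  have hd : `|h| < d.
    by near: h; apply: dnbhs0_lt.
  have he : `|h| <= e / (C + 1).
    by near: h; apply: dnbhs0_le; rewrite divr_gt0 //; lra.
  have [|_ [E W]] := H h; first by rewrite h0.
  rewrite distrC; apply: le_trans (_ : C * `|h| <= _).
    have := wbound_sup E W x; rewrite /GRing.scale /= mulr1 [h + t]addrC; apply.
  move: he; rewrite ler_pdivlMr; last by lra.
  by rewrite mulrDr mulr1; have := normr_ge0 h; nra.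
apply: DeriveDef; first by apply/cvg_ex; exists (vps (dcoef f) t x).
by apply: cvg_lim L; exact: Rhausdorff.
Unshelve. all: by end_near. Qed.

Lemma near_norm_lt (rho t : R) : `|t| < rho -> \forall t' \near t, `|t'| < rho.
Proof.
move=> trho; have d0 : 0 < rho - `|t| by rewrite subr_gt0.
apply/nbhs_ballP; exists (rho - `|t|) => //= t'; rewrite /ball /= => tt'.
by have := ler_normD (t' - t) t; rewrite subrK distrC; lra.
Qed.

Lemma vps_derive1n rho f x n : analytic_coefs rho f -> forall t, `|t| < rho ->
  derive1n n (fun t => vps f t x) t = vps (iter n dcoef f) t x.
Proof.
move=> af; elim: n => [//|n IH] t trho.
have E : \forall t' \near t,
    vps (iter n dcoef f) t' x = derive1n n (fun t => vps f t x) t'.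
  by apply: filterS (near_norm_lt trho) => t' /IH ->.
rewrite derive1nS derive1E -(near_eq_derive (1 : R) E).
by have [_ ->] := vps_is_derive x (analytic_iter_dcoef n af) trho.
Qed.

Lemma vps_derive1n_derivable rho f x n t : analytic_coefs rho f -> `|t| < rho ->
  derivable (derive1n n (fun t => vps f t x)) t 1.
Proof.
move=> af trho; have [dv _] := vps_is_derive x (analytic_iter_dcoef n af) trho.
apply: near_eq_derivable dv.
by apply: filterS (near_norm_lt trho) => t' t'rho; rewrite (vps_derive1n x n af).
Qed.

End PowerSeries.

(** * The power series of the branch *)

Section BranchRecursion.
Context {R : realType} (k : nat) (M : nat -> R).
Implicit Types (y : nat -> seq (R * nat)) (m n N : nat) (r t K : R).

(** The coefficient of t^m in y(t)^2. *)
Definition square_coef y m : seq (R * nat) :=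
  flatten [seq tmul (y i) (y (m - i)%N) | i <- index_iota 0 m.+1].

(** The coefficient of t^m in M([y^2]_k y - y^2); [tmap] with a constant function is multiplication
    by a scalar. *)
Definition next_coef y m : seq (R * nat) :=
  tmap M (flatten [seq tmap (fun=> coefc (square_coef y (m - i)%N) k) (y i)
                  | i <- index_iota 0 m.+1]
          ++ tmap (fun=> -1) (square_coef y m)).

(** Course-of-values recursion: a coefficient depends on all earlier ones, so the whole list is
    carried along. It starts from cos(kx). *)
Fixpoint branch_prefix m : seq (seq (R * nat)) :=
  if m is m'.+1 then
    rcons (branch_prefix m') (next_coef (nth [::] (branch_prefix m')) m')
  else [:: [:: (1, k)]].

Definition branch m : seq (R * nat) := nth [::] (branch_prefix m) m.

Lemma size_branch_prefix m : size (branch_prefix m) = m.+1.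
Proof. by elim: m => //= m IH; rewrite size_rcons IH. Qed.

Lemma nth_branch_prefix m i : (i <= m)%N -> nth [::] (branch_prefix m) i = branch i.
Proof.
elim: m => [|m IH]; first by rewrite leqn0 => /eqP ->.
rewrite leq_eqVlt => /orP[/eqP -> //|im].
by rewrite /= nth_rcons size_branch_prefix im IH.
Qed.

Lemma eq_square_coef y y' m : (forall i, (i <= m)%N -> y i = y' i) ->
  square_coef y m = square_coef y' m.
Proof.
move=> yy; congr flatten; apply/eq_in_map => i.
rewrite mem_index_iota ltnS => /andP[_ im].
by rewrite !yy // leq_subr.
Qed.

Lemma branchS m : branch m.+1 = next_coef branch m.
Proof.
rewrite /branch /= nth_rcons size_branch_prefix ltnn eqxx.
rewrite /next_coef; congr (tmap M (flatten _ ++ tmap _ _)); last first.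
  by apply: eq_square_coef => i im; rewrite nth_branch_prefix.
apply/eq_in_map => i; rewrite mem_index_iota ltnS => /andP[_ im].
rewrite nth_branch_prefix // (@eq_square_coef _ branch) // => j jm.
by rewrite nth_branch_prefix //; exact: leq_trans jm (leq_subr _ _).
Qed.

Lemma ev_flatten (I : Type) (s : seq I) (F : I -> seq (R * nat)) x :
  ev (flatten [seq F i | i <- s]) x = \sum_(i <- s) ev (F i) x.
Proof.
elim: s => [|i s IH]; first by rewrite /ev /= !big_nil.
by rewrite /= ev_cat IH big_cons.
Qed.

Lemma tnorm_flatten p (I : Type) (s : seq I) (F : I -> seq (R * nat)) :
  tnorm p (flatten [seq F i | i <- s]) = \sum_(i <- s) tnorm p (F i).
Proof.
elim: s => [|i s IH]; first by rewrite /tnorm /= !big_nil.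
by rewrite /= tnorm_cat IH big_cons.
Qed.

Lemma coefc_flatten (I : Type) (s : seq I) (F : I -> seq (R * nat)) n :
  coefc (flatten [seq F i | i <- s]) n = \sum_(i <- s) coefc (F i) n.
Proof.
elim: s => [|i s IH]; first by rewrite /coefc /= !big_nil.
by rewrite /= coefc_cat IH big_cons.
Qed.

Lemma ev_square_coef y m x :
  ev (square_coef y m) x = cauchy (fun i => ev (y i) x) (fun i => ev (y i) x) m.
Proof. by rewrite ev_flatten; apply: eq_bigr => i _; rewrite ev_tmul. Qed.

Definition tnorms p m : R := tnorm p (branch m).

Lemma tnorm_square_coef p m :
  tnorm p (square_coef branch m) <= cauchy (tnorms p) (tnorms p) m.
Proof. by rewrite tnorm_flatten; apply: ler_sum => i _; exact: tnorm_tmul. Qed.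

(** The coefficient of t^m in [y(t)^2]_k, hence of t^(m+1) in the wave speed. *)
Definition beta m : R := coefc (square_coef branch m) k.

Lemma norm_beta p m : `|beta m| <= cauchy (tnorms p) (tnorms p) m.
Proof. by apply: le_trans (norm_coefc_le p _ _) (tnorm_square_coef p m). Qed.

Lemma coefc_branchS m n : coefc (branch m.+1) n =
  M n * (cauchy (fun i => coefc (branch i) n) beta m - coefc (square_coef branch m) n).
Proof.
rewrite branchS coefc_tmap coefc_cat coefc_flatten coefc_tmap mulN1r.
by congr (_ * (_ - _)); apply: eq_bigr => i _; rewrite coefc_tmap mulrC.
Qed.

Lemma tnorms_ge0 p m : 0 <= tnorms p m. Proof. exact: tnorm_ge0. Qed.

(** The double convolution comes from the cubic term [y^2]_k y, the single one from y^2: the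
    recursion is reduced to a scalar one. *)
Lemma tnormsS p K m : (forall n, `|M n| <= K) -> tnorms p m.+1 <=
  K * (cauchy (tnorms p) (cauchy (tnorms p) (tnorms p)) m +
       cauchy (tnorms p) (tnorms p) m).
Proof.
move=> MK; have K0 : 0 <= K by apply: le_trans (MK 0%N).
rewrite /tnorms branchS; apply: le_trans (tnorm_tmap _ _ MK) _.
rewrite ler_wpM2l // tnorm_cat; apply: lerD.
  rewrite tnorm_flatten; apply: ler_sum => i _.
  apply: le_trans (tnorm_tmap _ _ (fun=> norm_beta p _)) _.
  by rewrite mulrC.
apply: le_trans (tnorm_tmap _ _ (_ : forall n, `|-1| <= 1)) _ => [n|].
  by rewrite normrN1.
by rewrite mul1r tnorm_square_coef.
Qed.

Local Notation W p := (k.+1%:R ^+ p : R).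

(* The majorant S_N <= W + r K (S_N^3 + S_N^2) keeps the partial sums below 2 W
   as long as r K (8 W^3 + 4 W^2) <= W. *)
Lemma branch_majorant p K r N : (forall n, `|M n| <= K) -> 0 <= r ->
  r * K * (8 * W p ^+ 3 + 4 * W p ^+ 2) <= W p ->
  series (fun m => r ^+ m * tnorms p m) N <= 2 * W p.
Proof.
move=> MK r0 rK; have K0 : 0 <= K by apply: le_trans (MK 0%N).
set w := k.+1%:R ^+ p in rK *; have w0 : 0 <= w by rewrite exprn_ge0.
pose a m := r ^+ m * tnorms p m.
have a0 m : 0 <= a m by rewrite mulr_ge0 ?exprn_ge0 ?tnorms_ge0.
elim: N => [|N IH]; first by rewrite /series /= big_geq // mulr_ge0.
rewrite /series /= big_nat_recl // expr0 mul1r.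
have -> : tnorms p 0 = w by rewrite /tnorms /tnorm big_seq1 /= normr1 mul1r.
set S := series a N in IH.
have S0 : 0 <= S by apply: sumr_ge0 => i _.
have c0 m : 0 <= cauchy a a m by exact: cauchy_ge0.
have aS m : r ^+ m.+1 * tnorms p m.+1 <=
    r * K * (cauchy a (cauchy a a) m + cauchy a a m).
  rewrite exprS -mulrA -[X in _ <= X]mulrA ler_wpM2l //.
  apply: le_trans (ler_wpM2l (exprn_ge0 _ r0) (tnormsS p m MK)) _.
  rewrite mulrCA ler_wpM2l // mulrDr !cauchyX lerD // le_eqVlt; apply/orP; left.
  by apply/eqP; apply: eq_bigr => i _; rewrite cauchyX.
have : \sum_(0 <= i < N) r ^+ i.+1 * tnorms p i.+1 <=
    r * K * (S ^+ 3 + S ^+ 2).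
  apply: (@le_trans _ _ (\sum_(0 <= i < N)
      r * K * (cauchy a (cauchy a a) i + cauchy a a i))).
    by apply: ler_sum => i _; exact: aS.
  rewrite -mulr_sumr ler_wpM2l ?mulr_ge0 // big_split /=.
  have s2 : series (cauchy a a) N <= S ^+ 2 by rewrite expr2; exact: series_cauchy_le.
  apply: lerD => //; apply: le_trans (series_cauchy_le _ a0 c0) _.
  by rewrite exprS ler_wpM2l.
have S3 : S ^+ 3 <= 8 * w ^+ 3.
  by rewrite (_ : 8 * w ^+ 3 = (2 * w) ^+ 3); [rewrite lerXn2r ?nnegrE ?mulr_ge0|ring].
have S2 : S ^+ 2 <= 4 * w ^+ 2.
  by rewrite (_ : 4 * w ^+ 2 = (2 * w) ^+ 2); [rewrite lerXn2r ?nnegrE ?mulr_ge0|ring].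
have : r * K * (S ^+ 3 + S ^+ 2) <= r * K * (8 * w ^+ 3 + 4 * w ^+ 2).
  by rewrite ler_wpM2l ?mulr_ge0 // lerD.
lra.
Qed.

Section Sum.
Context (p : nat) (K rho : R).
Hypotheses (MK : forall n, `|M n| <= K) (rho0 : 0 < rho).
Hypothesis rhoK : rho * K * (8 * W p ^+ 3 + 4 * W p ^+ 2) <= W p.

Let majorant r N : 0 <= r < rho -> series (fun m => r ^+ m * tnorms p m) N <= 2 * W p.
Proof.
move=> /andP[r0 rrho]; apply: (branch_majorant _ MK) => //.
apply: le_trans rhoK; have K0 : 0 <= K by apply: le_trans (MK 0%N).
rewrite -!mulrA ler_wpM2r //; last exact: ltW.
by rewrite mulr_ge0 // addr_ge0 // mulr_ge0 // !exprn_ge0.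
Qed.

Lemma analytic_branch : analytic_coefs p rho (fun m => ev (branch m)).
Proof.
split; first by move=> m; exact: even_periodic_ev.
exists (tnorms p); first by move=> m; exact: wbound_ev.
by move=> r hr; exists (2 * W p) => N; exact: majorant.
Qed.

Let square_majorant r N : 0 <= r < rho ->
  series (fun m => r ^+ m * cauchy (tnorms p) (tnorms p) m) N <= (2 * W p) ^+ 2.
Proof.
move=> hr; have /andP[r0 _] := hr.
have a0 m : 0 <= r ^+ m * tnorms p m by rewrite mulr_ge0 ?exprn_ge0 ?tnorms_ge0.
have -> : (fun m => r ^+ m * cauchy (tnorms p) (tnorms p) m) =
    cauchy (fun m => r ^+ m * tnorms p m) (fun m => r ^+ m * tnorms p m).
  by apply/funext => m; rewrite cauchyX.
apply: le_trans (series_cauchy_le _ a0 a0) _; rewrite expr2.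
by apply: ler_pM; rewrite ?sumr_ge0 ?majorant.
Qed.

Lemma analytic_square : analytic_coefs p rho (fun m => ev (square_coef branch m)).
Proof.
split; first by move=> m; exact: even_periodic_ev.
exists (cauchy (tnorms p) (tnorms p)).
  by move=> m; apply: wbound_le (tnorm_square_coef p m) _; exact: wbound_ev.
by move=> r hr; exists ((2 * W p) ^+ 2) => N; exact: square_majorant.
Qed.

Lemma radius_beta : radius_ge rho (fun m => `|beta m|).
Proof.
move=> r hr; exists ((2 * W p) ^+ 2) => N; apply: le_trans (square_majorant N hr).
by apply: ler_sum => m _; rewrite ler_wpM2l ?norm_beta // exprn_ge0 //; case/andP: hr.
Qed.

Definition profile t : R -> R := vps (fun m => ev (branch m)) t.

Lemma wbound_profile t : `|t| < rho ->
  even_periodic (profile t) /\ wbound p (profile t) (2 * W p).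
Proof.
move=> trho.
have hB N : series (fun m => `|t| ^+ m * tnorms p m) N <= 2 * W p.
  by apply: majorant; rewrite normr_ge0.
have eg m : even_periodic (fun x => t ^+ m * ev (branch m) x).
  by apply: even_periodicZ; exact: even_periodic_ev.
have gF m : wbound p (fun x => t ^+ m * ev (branch m) x) (`|t| ^+ m * tnorms p m).
  rewrite -normrX; apply: wboundZ (@wbound_ev _ p _).
  by case: (even_periodic_ev (branch m)).
by have [_ E B _] := superposition eg gF hB.
Qed.

Lemma amp_profile t n : `|t| < rho ->
  series (fun m => t ^+ m * coefc (branch m) n) @ \oo --> amp (profile t) n.
Proof.
move=> trho; have [_ [_ _ _ H]] := analytic_superposition analytic_branch trho.
by have := H n; under eq_fun do rewrite amp_ev.
Qed.

Lemma profile_square t x : `|t| < rho ->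
  profile t x ^+ 2 = vps (fun m => ev (square_coef branch m)) t x.
Proof.
move=> trho.
have b N : series (fun m => `|t ^+ m * ev (branch m) x|) N <= 2 * W p.
  apply: le_trans (_ : series (fun m => `|t| ^+ m * tnorms p m) N <= _); last first.
    by apply: majorant; rewrite normr_ge0.
  apply: ler_sum => m _; rewrite normrM normrX ler_wpM2l ?exprn_ge0 //.
  exact: wbound_sup (even_periodic_ev _) (@wbound_ev _ p _) x.
have := cauchy_product_cvg b b; rewrite -expr2 => H.
apply/esym/cvg_lim; first exact: Rhausdorff.
rewrite (_ : (fun m => t ^+ m * ev (square_coef branch m) x) =
  cauchy (fun m => t ^+ m * ev (branch m) x) (fun m => t ^+ m * ev (branch m) x)) //.
by apply/funext => m; rewrite ev_square_coef cauchyX.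
Qed.

Lemma amp_profile_square t n : `|t| < rho ->
  series (fun m => t ^+ m * coefc (square_coef branch m) n) @ \oo -->
    amp (fun x => profile t x ^+ 2) n.
Proof.
move=> trho; have [_ [_ _ _ H]] := analytic_superposition analytic_square trho.
have := H n; under eq_fun do rewrite amp_ev.
suff -> : (fun x => profile t x ^+ 2) = vps (fun m => ev (square_coef branch m)) t by [].
by apply/funext => x; rewrite profile_square.
Qed.

(** The zeroth coefficient cos(kx) gives [(k == n)], and the recursion for coefficient m + 1
    supplies the factor t. The cubic term is the Cauchy product of two absolutely convergent scalar
    series. *)
Lemma profile_equation t n : `|t| < rho -> amp (profile t) n = (k == n)%:R +
  t * (M n * (amp (fun x => profile t x ^+ 2) k * amp (profile t) n
              - amp (fun x => profile t x ^+ 2) n)).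
Proof.
move=> trho; rewrite -[LHS](cvg_lim (@Rhausdorff R) (amp_profile (n := n) trho)).
apply: cvg_lim; first exact: Rhausdorff.
rewrite -(cvg_shiftS (series _)).
pose b m := t ^+ m * beta m; pose a m := t ^+ m * coefc (branch m) n.
pose q m := t ^+ m * coefc (square_coef branch m) n.
have -> : (fun N => series a N.+1) = (fun N => (k == n)%:R +
    t * (M n * (series (cauchy a b) N - series q N))).
  apply/funext => N; rewrite /series /= big_nat_recl //=; congr (_ + _).
    by rewrite /a expr0 mul1r /coefc /branch /= big_mkcond big_seq1 /=; case: ifP.
  rewrite -sumrB !mulr_sumr; apply: eq_bigr => m _.
  by rewrite /a coefc_branchS /q -cauchyX exprS; ring.
have ca N : series (fun m => `|a m|) N <= 2 * W p.
  apply: le_trans (_ : series (fun m => `|t| ^+ m * tnorms p m) N <= _); last first.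
    by apply: majorant; rewrite normr_ge0.
  by apply: ler_sum => m _; rewrite normrM normrX ler_wpM2l ?exprn_ge0 // norm_coefc_le.
have cb N : series (fun m => `|b m|) N <= (2 * W p) ^+ 2.
  apply: le_trans (square_majorant N (_ : 0 <= `|t| < rho)); last by rewrite normr_ge0.
  by apply: ler_sum => m _; rewrite normrM normrX ler_wpM2l ?exprn_ge0 // norm_beta.
have cab := cauchy_product_cvg ca cb.
rewrite (cvg_lim (@Rhausdorff R) (amp_profile (n := n) trho)) in cab.
rewrite (cvg_lim (@Rhausdorff R) (amp_profile_square (n := k) trho)) mulrC in cab.
have cq := amp_profile_square (n := n) trho.
exact: (cvgD (cvg_cst _) (cvgM (cvg_cst t) (cvgM (cvg_cst (M n)) (cvgB cab cq)))).
Qed.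

End Sum.
End BranchRecursion.

(** * Uniqueness of the branch *)

Section BranchUniqueness.
Context {R : realType} (k : nat) (M : nat -> R) (K : R).
Hypothesis MK : forall n, `|M n| <= K.
Implicit Types (y v : R -> R) (n : nat).

Lemma le_add_geometric (x a b : R) : (forall j : nat, x <= a + b / 2 ^+ j) -> x <= a.
Proof.
move=> H; rewrite leNgt; apply/negP => ax; have xa : 0 < x - a by lra.
have b0 : 0 <= b by have := H 0%N; rewrite expr0 divr1; lra.
have q0 : 0 <= b / (x - a) by rewrite divr_ge0 // ltW.
have := archi_boundP q0; set j := Num.bound _ => bj.
have j2 : j%:R < 2 ^+ j :> R by rewrite -natrX ltr_nat ltn_expl.
have j0 : 0 < 2 ^+ j :> R by rewrite exprn_gt0.
have : b / (x - a) < 2 ^+ j by lra.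
rewrite ltr_pdivrMr // mulrC -ltr_pdivrMr // => h.
by have := H j; lra.
Qed.

(** Replaces the passage from |v| <= a + |v| / 2 to |v| <= 2 a: the improvement of the bound is
    iterated, and its excess over [2 * a] halves each time. Bounds stay below [A] because a
    quadratic term contracts only on a ball. *)
Lemma wbound_contraction v (a A : R) :
  (forall B, 0 <= B <= A -> wbound 0 v B -> wbound 0 v (a + B / 2)) -> 0 <= a ->
  wbound 0 v A -> wbound 0 v (2 * a).
Proof.
move=> H a0 vA; have A0 := wbound_ge0 vA.
have [Aa|aA] := leP A (2 * a); first exact: wbound_le vA.
have step j : wbound 0 v (2 * a + (A - 2 * a) / 2 ^+ j).
  elim: j => [|j IH]; first by rewrite expr0 divr1 addrC subrK.
  have j1 : 1 <= 2 ^+ j :> R by rewrite exprn_ege1 // ler1n.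
  have h0 : 0 <= (A - 2 * a) / 2 ^+ j by rewrite divr_ge0 //; lra.
  have h1 : (A - 2 * a) / 2 ^+ j <= A - 2 * a.
    rewrite ler_pdivrMr; last by lra.
    by rewrite ler_peMr //; lra.
  have := H (2 * a + (A - 2 * a) / 2 ^+ j); move/(_ _ IH) => H'.
  apply: wbound_le (H' _); last by apply/andP; split; lra.
  by rewrite exprS le_eqVlt; apply/orP; left; apply/eqP; field; rewrite gt_eqF //; lra.
by move=> N; apply: le_add_geometric => j; exact: step.
Qed.

Lemma amp0 n : amp (fun=> 0 : R) n = 0.
Proof. by rewrite /amp; under eq_fun do rewrite mul0r; rewrite avg_cst mulr0. Qed.

Lemma wbound_sqr p y (C : R) : even_periodic y -> wbound p y C ->
  wbound p (fun x => y x ^+ 2) (C * C).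
Proof.
move=> ey yC; suff -> : (fun x => y x ^+ 2) = (fun x => y x * y x) by exact: wboundM.
by apply/funext => x; rewrite expr2.
Qed.

Lemma even_periodic_sqr y : even_periodic y -> even_periodic (fun x => y x ^+ 2).
Proof.
move=> ey; suff -> : (fun x => y x ^+ 2) = (fun x => y x * y x) by exact: even_periodicM.
by apply/funext => x; rewrite expr2.
Qed.

(** One estimate for three purposes: the difference of two solutions, the a priori size of a small
    solution (with [t] equal to 1), and the distance of the branch from its leading term. *)
Lemma wbound_reduced p t (v w : R -> R) (b B C : R) : wbound p v B -> wbound p w C ->
  forall N, \sum_(0 <= n < N) `|t * (M n * (b * amp v n - amp w n))| * n.+1%:R ^+ p
    <= `|t| * K * (`|b| * B + C).
Proof.
move=> vB wC N; have K0 : 0 <= K by apply: le_trans (MK 0%N).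
apply: (@le_trans _ _ (`|t| * K * (`|b| * (\sum_(0 <= n < N) `|amp v n| * n.+1%:R ^+ p)
    + \sum_(0 <= n < N) `|amp w n| * n.+1%:R ^+ p))); last first.
  by rewrite ler_wpM2l ?mulr_ge0 // lerD // ler_wpM2l.
rewrite mulr_sumr -big_split /= mulr_sumr; apply: ler_sum => n _.
rewrite [leRHS](_ : _ = `|t| * K * (`|b| * `|amp v n| + `|amp w n|) * n.+1%:R ^+ p);
  last by ring.
rewrite ler_wpM2r ?exprn_ge0 // normrM [`|M n * _|]normrM mulrA; apply: ler_pM => //.
  by rewrite ler_wpM2l.
by apply: le_trans (ler_normB _ _) _; rewrite normrM.
Qed.

(* The fixed-point equation y = e + t M ([y^2]_k y - y^2), mode by mode. *)
Definition branch_equation t y : Prop := forall n, amp y n = (k == n)%:R +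
  t * (M n * (amp (fun x => y x ^+ 2) k * amp y n - amp (fun x => y x ^+ 2) n)).

(** The difference z = y - y' satisfies z = t M(b z - w + [w]_k y') with w = z (y + y') and b =
    [y^2]_k. The three terms contribute C^2, 2 C and 2 C^2 times the bound of z, which explains the
    condition on [t]. *)
Lemma branch_equation_unique t y y' (C : R) : even_periodic y -> even_periodic y' ->
  wbound 0 y C -> wbound 0 y' C -> branch_equation t y -> branch_equation t y' ->
  `|t| * K * (3 * C ^+ 2 + 2 * C) <= 2^-1 -> y = y'.
Proof.
move=> ey ey' yC y'C by_ by' tK.
have C0 := wbound_ge0 yC; have K0 : 0 <= K by apply: le_trans (MK 0%N).
have cy : continuous y by case: ey.
have cy' : continuous y' by case: ey'.
pose z x := y x + -1 * y' x.
have ez : even_periodic z by apply: even_periodicD => //; exact: even_periodicZ.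
have cNy' : continuous (fun x => -1 * y' x).
  by apply: continuous_funM => //; exact: continuous_fun_cst.
have ampz n : amp z n = amp y n - amp y' n by rewrite ampD // ampZ // mulN1r.
pose w x := z x * (y x + y' x).
have ampw n : amp (fun x => y x ^+ 2) n - amp (fun x => y' x ^+ 2) n = amp w n.
  rewrite -ampB; try by apply: continuous_funX.
  by congr amp; apply/funext => x; rewrite /w /z; ring.
have zC : wbound 0 z (C + C).
  have := wboundZ (-1) cy' y'C; rewrite normrN1 mul1r; exact: wboundD.
suff z0 : wbound 0 z (2 * 0).
  apply: even_periodic_amp_inj => // n; apply/eqP; rewrite -subr_eq0 -ampz.
  by rewrite -normr_le0 -(mulr0 2); exact: wbound_amp z0.
apply: wbound_contraction zC => // A /andP[A0 _] zA; rewrite add0r.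
have wA : wbound 0 w (A * (C + C)).
  by apply: wboundM => //; [exact: even_periodicD|exact: wboundD].
pose b := amp (fun x => y x ^+ 2) k.
have bC : `|b| <= C * C := wbound_amp k (wbound_sqr ey yC).
have wk : `|amp w k| <= A * (C + C) := wbound_amp k wA.
have zE n : amp z n = t * (M n * (b * amp z n - amp w n)) +
    t * (M n * (amp w k * amp y' n - 0)).
  rewrite [LHS]ampz [in LHS]by_ [in LHS]by' -/b.
  have -> : amp (fun x => y x ^+ 2) n = amp (fun x => y' x ^+ 2) n + amp w n.
    by rewrite -ampw addrC subrK.
  have -> : amp (fun x => y' x ^+ 2) k = b - amp w k by rewrite -ampw opprB addrC subrK.
  by rewrite ampz; ring.
have z0 : wbound 0 (fun=> 0 : R) 0.
  by move=> N; rewrite big1 // => n _; rewrite amp0 normr0 mul0r.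
move=> N; have h1 := wbound_reduced t b zA wA N.
have := wbound_reduced t (amp w k) y'C z0 N => h2.
under eq_bigr do rewrite zE.
apply: le_trans (_ : _ <= `|t| * K * (C * C * A + A * (C + C)) +
    `|t| * K * (A * (C + C) * C + 0)) _.
  apply: le_trans (_ : _ <= \sum_(0 <= n < N)
      (`|t * (M n * (b * amp z n - amp w n))| * n.+1%:R ^+ 0 +
      `|t * (M n * (amp w k * amp y' n - amp (fun=> 0) n))| * n.+1%:R ^+ 0)) _.
    by apply: ler_sum => n _; rewrite amp0 -mulrDl ler_wpM2r ?exprn_ge0 // ler_normD.
  rewrite big_split /=; apply: lerD.
    apply: le_trans h1 _; rewrite ler_wpM2l ?mulr_ge0 // lerD2r ler_wpM2r //.
  by apply: le_trans h2 _; rewrite ler_wpM2l ?mulr_ge0 // lerD2r ler_wpM2r.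
have -> : `|t| * K * (C * C * A + A * (C + C)) + `|t| * K * (A * (C + C) * C + 0) =
  `|t| * K * (3 * C ^+ 2 + 2 * C) * A by ring.
by rewrite [leRHS]mulrC ler_wpM2r.
Qed.

End BranchUniqueness.

(** * The steady equation, mode by mode *)

Section WhithamOperator.
Context {R : realType} (kappa T : R).
Hypotheses (hkappa : 0 < kappa) (hT : 0 < T).
Implicit Types (u v : R -> R) (n k : nat).

Local Notation l n := (scaled_symbol kappa T n%:R).

Lemma scaled_symbol_bounded : exists L : R, forall n, `|l n| <= L.
Proof.
have [N HN] := scaled_symbol_small hkappa hT (@ltr01 R).
have S0 : 0 <= \sum_(0 <= n < N) `|l n| by rewrite sumr_ge0.
exists (1 + \sum_(0 <= n < N) `|l n|) => n; have [nN|Nn] := ltnP n N.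
  rewrite (bigD1_seq n) ?iota_uniq ?mem_index_iota //= addrCA lerDl addr_ge0 //.
  by rewrite sumr_ge0.
rewrite gtr0_norm; last exact: scaled_symbol_gt0.
by have := HN n Nn; lra.
Qed.

(** The operator is a pointwise limit; [superposition] shows that the limit is uniform, so its
    amplitudes may be computed term by term. *)
Lemma amp_whitham_op u (B : R) : even_periodic u -> wbound 0 u B ->
  even_periodic (whitham_op kappa T u) /\
  forall n, amp (whitham_op kappa T u) n = l n * amp u n.
Proof.
move=> eu uB; have [L lL] := scaled_symbol_bounded.
have L0 : 0 <= L by apply: le_trans (lL 0%N).
pose F n (x : R) := l n * amp u n * cos (n%:R * x).
have eF n : even_periodic (F n) by apply: even_periodicZ; exact: even_periodic_cos.
have FL n : wbound 0 (F n) (L * `|amp u n|).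
  have := wboundZ (l n * amp u n) (@continuous_cosM R n%:R) (@wbound_cos R 0 n).
  by rewrite expr0 mulr1 normrM; apply: wbound_le; rewrite ler_wpM2r.
have FB N : series (fun n => L * `|amp u n|) N <= L * B.
  rewrite /series /= -mulr_sumr ler_wpM2l //; apply: le_trans (uB N).
  by apply: ler_sum => n _; rewrite expr0 mulr1.
have [U E _ A] := superposition eF FL FB.
have -> : whitham_op kappa T u = (fun x => limn (series (F ^~ x))).
  by apply/funext => x; apply: whitham_op_cvg => //; exact: (uniformly_to_cvg U).
split=> // n; rewrite -(cvg_lim (@Rhausdorff R) (A n)).
have ampF m : amp (F m) n = l m * amp u m * (m == n)%:R.
  by rewrite ampZ ?amp_cos //; exact: continuous_cosM.
have H := @series_eventually_cst R (fun m => amp (F m) n) n.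
rewrite (cvg_lim (@Rhausdorff R) (H _)).
  by rewrite ampF eqxx mulr1.
by move=> m mn; rewrite ampF (negbTE mn) mulr0.
Qed.

Lemma amp_whitham_map u (d B : R) : even_periodic u -> wbound 0 u B ->
  even_periodic (whitham_map kappa T u d) /\
  forall n, amp (whitham_map kappa T u d) n =
    (1 - d * l n) * amp u n + l n * amp (fun x => u x ^+ 2) n.
Proof.
move=> eu uB; have [e1 a1] := amp_whitham_op eu uB.
have [e2 a2] := amp_whitham_op (even_periodic_sqr eu) (wbound_sqr eu uB).
have e1' := even_periodicZ (- d) e1.
have -> : whitham_map kappa T u d = (fun x => (u x + - d * whitham_op kappa T u x) +
    whitham_op kappa T (fun y => u y ^+ 2) x).
  by apply/funext => x; rewrite /whitham_map mulNr.
have [c0 _ _] := eu; have [c1 _ _] := e1; have [c2 _ _] := e2; have [c1' _ _] := e1'.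
split; first by do 2 apply: even_periodicD => //.
move=> n; rewrite ampD //; last exact: continuous_funD.
by rewrite ampD // ampZ // a1 a2; ring.
Qed.

Lemma whitham_map_eq0 u (d B : R) : even_periodic u -> wbound 0 u B ->
  whitham_map kappa T u d = cst 0 <->
  forall n, (1 - d * l n) * amp u n + l n * amp (fun x => u x ^+ 2) n = 0.
Proof.
move=> eu uB; have [e a] := amp_whitham_map d eu uB; split=> [H n|H].
  by rewrite -a H amp0.
by apply/funext => x; apply: even_periodic_amp0 => // n; rewrite a.
Qed.

(* Mode k of the equation fixes the wave speed; all the other modes are solved
   for the amplitude by the bounded inverse on the complement of the kernel. *)
Lemma mode_split k (a s : nat -> R) (d : R) : (forall n, n != k -> l n != l k) ->
  (forall n, (1 - d * l n) * a n + l n * s n = 0) <->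
  (d - (l k)^-1) * a k = s k /\
  forall n, a n = (k == n)%:R * a k +
    reduced_inverse kappa T k n * ((d - (l k)^-1) * a n - s n).
Proof.
move=> lk; have lk0 := scaled_symbol_gt0 hkappa hT k.
have lkn0 : l k != 0 by rewrite gt_eqF.
have dn0 n : n != k -> 1 - (l k)^-1 * l n != 0.
  move=> /lk; apply: contra; rewrite subr_eq0 => /eqP x1.
  by rewrite -[l n](mulVKf lkn0) -x1 mulr1.
split=> [H|[Hk H] n].
  have Hk : (d - (l k)^-1) * a k = s k.
    have := H k; have -> : (1 - d * l k) * a k + l k * s k =
      l k * (s k - (d - (l k)^-1) * a k) by field.
    by move/eqP; rewrite mulf_eq0 (negbTE lkn0) /= subr_eq0 => /eqP.
  split=> // n; rewrite /reduced_inverse eq_sym; have [->|nk] := eqVneq n k.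
    by rewrite mul0r addr0 mul1r.
  rewrite mul0r add0r; apply: (mulfI (dn0 n nk)).
  rewrite mulrA mulrCA divff ?dn0 // mulr1.
  apply/eqP; rewrite -subr_eq0; apply/eqP; rewrite -[RHS](H n); ring.
have [->|nk] := eqVneq n k; first by rewrite -Hk; field.
have := H n; rewrite /reduced_inverse eq_sym (negbTE nk) mul0r add0r => Hn.
have : (1 - (l k)^-1 * l n) * a n = l n * ((d - (l k)^-1) * a n - s n).
  by rewrite {1}Hn mulrA mulrCA divff ?dn0 // mulr1.
by move/eqP; rewrite -subr_eq0 => /eqP h; rewrite -[RHS]h; ring.
Qed.

End WhithamOperator.

(** * Power series with a prescribed constant term *)

Section ShiftedSeries.
Context {R : realType} (p : nat) (rho : R).
Implicit Types (f : nat -> R -> R) (g : R -> R) (t : R).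

(** The series g + t f(t): both u(t) = t y(t) and c(t) = c0 + t [y(t)^2]_k have this form. *)
Definition cons_coef g f m : R -> R := if m is m'.+1 then f m' else g.

Lemma analytic_cons g f (B : R) : even_periodic g -> wbound p g B ->
  analytic_coefs p rho f -> analytic_coefs p rho (cons_coef g f).
Proof.
move=> eg gB [ef [F fF Frho]]; split; first by case.
exists (fun m => if m is m'.+1 then F m' else B); first by case.
move=> r hr; have [C FC] := Frho r hr; exists (B + r * C) => N.
have r0 : 0 <= r by case/andP: hr.
have C0 : 0 <= C by apply: le_trans (FC 0%N); rewrite /series /= big_geq.
case: N => [|N].
  by rewrite /series /= big_geq // addr_ge0 ?mulr_ge0 ?(wbound_ge0 gB).
rewrite /series /= big_nat_recl //= expr0 mul1r lerD2l.
apply: le_trans (ler_wpM2l r0 (FC N)); rewrite /series /= mulr_sumr.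
by apply: ler_sum => i _; rewrite exprS mulrA.
Qed.

Lemma vps_cons g f t x : analytic_coefs p rho f -> `|t| < rho ->
  vps (cons_coef g f) t x = g x + t * vps f t x.
Proof.
move=> af trho; have [B [_ _ H _]] := analytic_superposition af trho.
apply: cvg_lim; first exact: Rhausdorff.
rewrite -(cvg_shiftS (series _)).
have -> : (fun N => series (fun m => t ^+ m * cons_coef g f m x) N.+1) =
    (fun N => g x + t * series (fun m => t ^+ m * f m x) N).
  apply/funext => N; rewrite /series /= big_nat_recl //= expr0 mul1r mulr_sumr.
  by congr (_ + _); apply: eq_bigr => i _; rewrite exprS mulrA.
exact: (cvgD (cvg_cst _) (cvgM (cvg_cst t) (H x))).
Qed.

Lemma wbound_cst (a : R) : wbound p (fun=> a) `|a|.
Proof.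
have -> : (fun=> a) = ev [:: (a, 0%N)].
  by apply/funext => x; rewrite /ev big_seq1 /= mul0r cos0 mulr1.
suff -> : `|a| = tnorm p [:: (a, 0%N)] by exact: wbound_ev.
by rewrite /tnorm big_seq1 /= expr1n mulr1.
Qed.

Lemma even_periodic_cst (a : R) : even_periodic (fun=> a).
Proof. by split=> //; exact: continuous_fun_cst. Qed.

(** Scalar series become series of constant functions, so that the same calculus yields the
    smoothness of the wave speed. *)
Lemma analytic_cst (a : nat -> R) : radius_ge rho (fun m => `|a m|) ->
  analytic_coefs p rho (fun m _ => a m).
Proof.
move=> ar; split; first by move=> m; exact: even_periodic_cst.
by exists (fun m => `|a m|) => // m; exact: wbound_cst.
Qed.

End ShiftedSeries.

(** * The bifurcation theorem *)

Section Smoothness.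
Context {R : realType} (psi : nat -> R -> R).
Hypothesis hpsi : zygmund_partition psi.
Implicit Types (s rho : R) (p : nat).

Lemma even_periodic_zygmund s (u : R -> R) : zygmund_even psi s u -> even_periodic u.
Proof. by case=> [[cu pu _] eu]. Qed.

Lemma zygmund_norm_ge0 s (u : R -> R) : (0 <= zygmund_norm psi s u)%E.
Proof.
apply: (@le_trans _ _ (2 `^ (0%N%:R * s) *
    ComplexField.Normc.normc (multiplier (fun xi => psi 0%N xi ^+ 2) u 0))%:E).
  rewrite lee_fin mulr_ge0 ?powR_ge0 //.
  by case: (multiplier _ _ _) => a b; exact: sqrtr_ge0.
by apply: ereal_sup_ubound; exists 0%N => //; exists 0.
Qed.

(** The derivatives are the term-by-term ones. The error of the difference quotient is small in the
    weighted algebra, which embeds into the Zygmund space because [s <= p]. *)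
Lemma vps_smooth_curve s p rho (f : nat -> R -> R) : s <= p%:R ->
  analytic_coefs p rho f -> zygmund_smooth_curve psi s rho (vps f).
Proof.
move=> sp af; exists (fun n => vps (iter n dcoef f)); split=> // n t trho.
have an := analytic_iter_dcoef n af.
split.
  have [B [e w _ _]] := analytic_superposition an trho.
  exact: (zygmund_even_wbound hpsi e sp w).
have [C [d [C0 d0 H]]] := vps_difference_quotient an trho.
pose D := 2 * 4 ^+ p * C.
have D0 : 0 <= D by rewrite mulr_ge0 // mulr_ge0 // exprn_ge0.
apply: (@squeeze_cvge _ _ _ _ (fun=> 0%E) _ (fun h => (D * `|h|)%:E)).
- near=> h; rewrite zygmund_norm_ge0 /=.
  have h0 : 0 < `|h| by rewrite normr_gt0; near: h; exact: nbhs_dnbhs_neq.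
  have hd : `|h| < d by near: h; exact: dnbhs0_lt.
  have [|_ [E W]] := H h; first by rewrite h0.
  by have := zygmund_norm_le_wbound hpsi E sp W; rewrite mulrA.
- exact: cvg_cst.
apply: cvg_EFin; first by near=> h.
have : D * `|h| @[h --> (0 : R)] --> D * `|0 : R|.
  by apply: cvgM; [exact: cvg_cst|apply: cvg_norm; exact: cvg_id].
rewrite normr0 mulr0; apply: cvg_trans; apply: cvg_app; exact: nbhs_dnbhs.
Unshelve. all: by end_near. Qed.

End Smoothness.

Theorem theorem3p1 (R : realType) (psi : nat -> R -> R)
    (hpsi : zygmund_partition psi) (s : R) (hs : 1 / 2 < s)
    (k : nat) (hk : (1 <= k)%N) (T kappa : R) (hT : 0 < T) (hkappa : 0 < kappa)
    (c0 : R) (hc0 : c0 = (scaled_symbol kappa T k%:R)^-1)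
    (hker : has_dim (linearization_kernel psi s kappa T c0) 1) :
  exists (eps : R) (u : R -> R -> R) (c : R -> R),
    [/\ 0 < eps,
        (* the curve is smooth *)
        zygmund_smooth_curve psi s eps u /\
        (forall n t, `|t| < eps -> derivable (derive1n n c) t 1),
        (* its points are nontrivial even periodic solutions *)
        (forall t, 0 < `|t| < eps ->
          [/\ zygmund_even psi s (u t), u t <> cst 0 &
              whitham_map kappa T (u t) (c t) = cst 0]),
        (* with the given asymptotics *)
        (exists C : R, forall t, 0 < `|t| < eps ->
          (zygmund_norm psi s (fun x => (u t x - t * cos (k%:R * x))%R)
             <= (C * t ^+ 2)%:E)%E /\
          `|c t - c0| <= C * `|t|) &
        (* and they are all the nontrivial solutions near (0, c0) *)
        (exists delta : R, 0 < delta /\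
          forall (v : R -> R) (d : R),
            zygmund_even psi s v -> (zygmund_norm psi s v < delta%:E)%E ->
            `|d - c0| < delta -> v <> cst 0 ->
            whitham_map kappa T v d = cst 0 ->
            exists t, [/\ 0 < `|t| < eps, v = u t & d = c t])].
Proof.
subst c0; have s0 : 0 <= s by lra.
have lk := simple_kernel hkappa hT hpsi hker.
set c0 := (scaled_symbol kappa T k%:R)^-1.
pose p := Num.bound s; have sp : s <= p%:R by exact: ltW (archi_boundP s0).
pose M := reduced_inverse kappa T k.
have [K K0 MK] : exists2 K : R, 0 < K & forall n, `|M n| <= K.
  exact: reduced_inverse_bounded.
pose W : R := k.+1%:R ^+ p.
have W1 : 1 <= W by rewrite exprn_ege1 // ler1n.
(* [A] is the constant of [branch_majorant], and [A'] that of [branch_equation_unique] for the bound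
   [C = 2 * W]. *)
pose A := 8 * W ^+ 3 + 4 * W ^+ 2.
have A0 : 0 < A by rewrite addr_gt0 // mulr_gt0 // exprn_gt0 //; lra.
pose A' := 3 * (2 * W) ^+ 2 + 2 * (2 * W).
have A'0 : 0 < A' by rewrite addr_gt0 // ?mulr_gt0 ?exprn_gt0 ?mulr_gt0 //; lra.
pose eps := Num.min (W / (K * A)) (2^-1 / (K * A')).
have eps0 : 0 < eps by rewrite lt_min !divr_gt0 ?mulr_gt0 //; lra.
have epsK : eps * K * A <= W.
  by rewrite -mulrA -ler_pdivlMr ?mulr_gt0 // ge_min lexx.
have epsK' t : `|t| < eps -> `|t| * K * A' <= 2^-1.
  move=> te; rewrite -mulrA -ler_pdivlMr ?mulr_gt0 //; apply: ltW.
  by apply: lt_le_trans te _; rewrite ge_min lexx orbT.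
pose Y := profile k M.
have af : analytic_coefs p eps (fun m => ev (branch k M m)) := analytic_branch MK epsK.
have ab : analytic_coefs p eps (fun m (_ : R) => beta k M m).
  by apply: analytic_cst; exact: (radius_beta MK epsK).
have au : analytic_coefs p eps (cons_coef (fun=> 0) (fun m => ev (branch k M m))).
  by apply: analytic_cons af; [exact: even_periodic_cst|exact: wbound_cst].
have ac : analytic_coefs p eps (cons_coef (fun=> c0) (fun m _ => beta k M m)).
  by apply: analytic_cons ab; [exact: even_periodic_cst|exact: wbound_cst].
pose u := vps (cons_coef (fun=> 0 : R) (fun m => ev (branch k M m))).
pose c t := vps (cons_coef (fun=> c0) (fun m (_ : R) => beta k M m)) t 0.
have uE t : `|t| < eps -> u t = (fun x => t * Y t x).
  by move=> te; apply/funext => x; rewrite /u (vps_cons _ _ af te) add0r.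
have cE t : `|t| < eps -> c t = c0 + t * amp (fun x => Y t x ^+ 2) k.
  move=> te; rewrite /c (vps_cons _ _ ab te); congr (_ + _ * _).
  by apply: cvg_lim; [exact: Rhausdorff|exact: (amp_profile_square MK epsK te)].
have YW t : `|t| < eps -> even_periodic (Y t) /\ wbound p (Y t) (2 * W).
  exact: (wbound_profile MK epsK).
have Yeq t : `|t| < eps -> branch_equation k M t (Y t).
  by move=> te n; exact: (profile_equation MK epsK n te).
(* [M] vanishes at [k], so the profile has k-th amplitude 1. Hence t is the k-th amplitude of [u t],
   which makes [u t] nonzero. *)
have ampYk t : `|t| < eps -> amp (Y t) k = 1.
  move=> te; rewrite (Yeq t te k) eqxx /M /reduced_inverse eqxx mul0r mulr0.
  by rewrite addr0.
have YB t : `|t| < eps -> `|amp (fun x => Y t x ^+ 2) k| <= 2 * W * (2 * W).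
  by move=> te; have [eY wY] := YW t te; exact: wbound_amp (wbound_sqr eY wY).
have amp_sqrZ (t : R) (y : R -> R) n : even_periodic y ->
    amp (fun x => (t * y x) ^+ 2) n = t ^+ 2 * amp (fun x => y x ^+ 2) n.
  move=> ey; rewrite -ampZ; last by case: (even_periodic_sqr ey).
  by congr amp; apply/funext => x; rewrite exprMn.
exists eps, u, c; split=> //.
- split; first exact: (vps_smooth_curve hpsi sp au).
  by move=> n t te; exact: vps_derive1n_derivable ac te.
- move=> t /andP[t0 te]; have [eY wY] := YW t te; rewrite uE //.
  have [cY _ _] := eY.
  have eu : even_periodic (fun x => t * Y t x) by exact: even_periodicZ.
  have wu : wbound p (fun x => t * Y t x) (`|t| * (2 * W)) by exact: wboundZ.
  split; first exact: (zygmund_even_wbound hpsi eu sp wu).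
    move=> u0; have := ampZ t k cY; rewrite u0 amp0 ampYk // mulr1 => t0'.
    by rewrite -t0' normr0 ltxx in t0.
  apply/(whitham_map_eq0 hkappa hT _ eu (wboundW wu)).
  apply/(mode_split hkappa hT _ _ _ lk); rewrite cE // -/c0 [c0 + _]addrC addrK.
  split=> [|n]; rewrite !ampZ // ampYk // !amp_sqrZ //; first by ring.
  by rewrite [in LHS](Yeq t te n) -/M; ring.
(* As u - t cos(kx) = t^2 M([y^2]_k y - y^2), the first constant is a bound of this image times the
   embedding constant; the second bounds [y^2]_k. *)
- exists (Num.max (2 * 4 ^+ p * (K * (2 * W * (2 * W) * (2 * W) + 2 * W * (2 * W))))
            (2 * W * (2 * W))) => t /andP[t0 te].
  have [eY wY] := YW t te; have [cY _ _] := eY.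
  split; last first.
    rewrite cE // addrC addKr normrM mulrC; apply: ler_wpM2r => //.
    by apply: le_trans (YB t te) _; rewrite le_max lexx orbT.
  pose z x := t * (Y t x + -1 * cos (k%:R * x)).
  have ecos : even_periodic (fun x : R => -1 * cos (k%:R * x)).
    by apply: even_periodicZ; exact: even_periodic_cos.
  have [ccos _ _] := ecos.
  have ez : even_periodic z by apply: even_periodicZ; exact: even_periodicD.
  have -> : (fun x => u t x - t * cos (k%:R * x)) = z.
    by apply/funext => x; rewrite uE // /z; ring.
  have ampz n : amp z n = t * (t * (M n * (amp (fun x => Y t x ^+ 2) k * amp (Y t) n
      - amp (fun x => Y t x ^+ 2) n))).
    rewrite ampZ; last exact: continuous_funD.
    rewrite ampD // ampZ; last exact: continuous_cosM.
    by rewrite amp_cos {1}(Yeq t te n); ring.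
  have wz : wbound p z (t ^+ 2 * (K * (2 * W * (2 * W) * (2 * W) + 2 * W * (2 * W)))).
    move=> N; under eq_bigr do rewrite ampz normrM -mulrA.
    rewrite -mulr_sumr -[t ^+ 2](real_normK (num_real t)) expr2 -!mulrA ler_wpM2l //.
    have := wbound_reduced MK t (amp (fun x => Y t x ^+ 2) k) wY (wbound_sqr eY wY) N.
    move/le_trans; apply; rewrite -mulrA ler_wpM2l // ler_wpM2l ?(ltW K0) //.
    have W20 : 0 <= 2 * W by lra.
    by have := ler_wpM2r W20 (YB t te); lra.
  apply: le_trans (zygmund_norm_le_wbound hpsi ez sp wz) _; rewrite lee_fin.
  rewrite [leLHS]mulrCA [leLHS]mulrC; apply: ler_wpM2r; first exact: sqr_ge0.
  by rewrite le_max lexx.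
have [Cz Cz0 HCz] := wbound_zygmund_norm hpsi hs.
(* The first entry makes the equation for [v] contract by a factor 1/2; the second keeps the k-th
   amplitude of [v], at most [Cz * delta], below [eps]. *)
pose delta := Num.min (2^-1 / (K * (1 + Cz))) (eps / (2 * Cz)).
have d0 : 0 < delta by rewrite lt_min !divr_gt0 ?mulr_gt0 //; lra.
have dK : K * (delta + Cz * delta) <= 2^-1.
  have -> : K * (delta + Cz * delta) = delta * (K * (1 + Cz)) by ring.
  by rewrite -ler_pdivlMr ?mulr_gt0 ?ge_min ?lexx //; lra.
have dC : Cz * delta < eps.
  apply: (@le_lt_trans _ _ (eps / 2)); last by lra.
  have : delta <= eps / (2 * Cz) by rewrite ge_min lexx orbT.
  by rewrite ler_pdivlMr ?mulr_gt0 //; lra.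
exists delta; split=> // v d zv vd dd v0 sol.
have ev := even_periodic_zygmund zv; have [cv _ _] := ev.
have vB := HCz v delta ev d0 (ltW vd).
move: sol => /(whitham_map_eq0 hkappa hT _ ev vB).
move=> /(mode_split hkappa hT _ _ _ lk); rewrite -/c0 -/M => -[vk vn].
pose t := amp v k.
(* The fixed-point form before rescaling: v = t e + M((d - c0) v - v^2), where the wave speed is
   still independent data. *)
have v2t : wbound 0 v (2 * `|t|).
  apply: wbound_contraction vB => // B /andP[B0 Bd] wB N.
  have h := wbound_reduced MK 1 (d - c0) wB (wbound_sqr ev wB) N.
  have hB : K * (`|d - c0| * B + B * B) <= B / 2.
    have : K * (`|d - c0| + B) <= 2^-1.
      apply: le_trans dK; rewrite ler_wpM2l ?(ltW K0) // lerD //; exact: ltW.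
    move=> /(ler_wpM2r B0); lra.
  rewrite normr1 mul1r in h.
  apply: le_trans (_ : _ <= \sum_(0 <= n < N) (`|(k == n)%:R * t| +
      `|1 * (M n * ((d - c0) * amp v n - amp (fun x => v x ^+ 2) n))| * n.+1%:R ^+ 0)) _.
    by apply: ler_sum => n _; rewrite expr0 !mulr1 mul1r {1}vn ler_normD.
  rewrite big_split /=; apply: lerD; last exact: le_trans h hB.
  have [kN|Nk] := ltnP k N.
    rewrite (bigD1_seq k) ?iota_uniq ?mem_index_iota //= eqxx mul1r big1 ?addr0 // => i.
    by rewrite eq_sym => /negbTE ->; rewrite mul0r normr0.
  rewrite big1_seq // => i; rewrite mem_index_iota => /andP[_ /andP[_ iN]].
  by rewrite gtn_eqF ?mul0r ?normr0 // (leq_trans iN).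
have t0 : t != 0.
  apply/eqP => t0; apply: v0; apply/funext => x; apply: even_periodic_amp0 => // n.
  apply/eqP; rewrite -normr_le0; have := wbound_amp n v2t.
  by rewrite t0 normr0 mulr0.
have te : `|t| < eps by apply: le_lt_trans dC; exact: wbound_amp vB.
exists t; rewrite normr_gt0 t0 te.
pose y x := t^-1 * v x.
have ey : even_periodic y by exact: even_periodicZ.
(* The bound 2 is relaxed to that of the branch, so that one constant serves both solutions. *)
have yW : wbound 0 y (2 * W).
  apply: (@wbound_le _ _ _ (`|t^-1| * (2 * `|t|))); last exact: wboundZ.
  by rewrite normfV mulrCA mulVf ?normr_eq0 // mulr1; lra.
have ampy n : amp y n = t^-1 * amp v n by rewrite ampZ.
have mu : d - c0 = t * amp (fun x => y x ^+ 2) k.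
  apply: (mulIf t0); rewrite amp_sqrZ // vk.
  by rewrite mulrA [t * _]mulrC; field.
have yeq : branch_equation k M t y.
  by move=> n; rewrite ampy {1}vn mu !amp_sqrZ // -/t; field.
have [eY wY] := YW t te.
have yY : y = Y t.
  apply: (branch_equation_unique MK ey eY yW (wboundW wY) yeq (Yeq t te)).
  exact: epsK'.
split=> //; last by rewrite cE // -yY -mu addrC subrK.
by rewrite uE // -yY; apply/funext => x; rewrite /y mulVKf.
Qed.
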